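(* Let $T\in(0,\infty)$ be fixed. We have $$\mathsf{P}\left(\limsup_{t\uparrow T}\frac{X_t^{(1/2)}}{\sqrt{2(T-t)\left(\ln\frac{1}{T-t}\right)\left(\ln\ln\ln\frac{1}{T-t}\right)}}=1\right)=\mathsf{P}\left(\liminf_{t\uparrow T}\frac{X_t^{(1/2)}}{\sqrt{2(T-t)\left(\ln\frac{1}{T-t}\right)\left(\ln\ln\ln\frac{1}{T-t}\right)}}=-1\right)=1.$$ Especially, $$\mathsf{P}\left(\limsup_{t\uparrow T}\frac{X_t^{(1/2)}}{\sqrt{T-t}}=\infty\right)=\mathsf{P}\left(\liminf_{t\uparrow T}\frac{X_t^{(1/2)}}{\sqrt{T-t}}=-\infty\right)=1.$$
   Context: Let $(B_t)_{t\geq 0}$ be a one-dimensional standard Wiener process on a probability space $(\Omega,\mathcal{A},\mathsf{P})$ (with a filtration constructed from $B$ satisfying the usual conditions). For $\alpha\in\mathbb{R}$, $(X_t^{(\alpha)})_{t\in[0,T)}$ denotes the unique strong solution (with continuous paths) of the SDE $$\mathrm{d}X_t^{(\alpha)}=-\frac{\alpha}{T-t}X_t^{(\alpha)}\,\mathrm{d}t+\mathrm{d}B_t,\quad t\in[0,T),\qquad X_0^{(\alpha)}=0,$$ namely $X_t^{(\alpha)}=\int_0^t\left(\frac{T-t}{T-s}\right)^\alpha\mathrm{d}B_s$, $t\in[0,T)$; $X^{(1/2)}$ is the case $\alpha=\frac12$. The normalizing expressions with iterated logarithms are considered only for $t$ sufficiently close to $T$, where they are well defined and positive. *)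

(* Defs.v *)
From HB Require Import structures.
From mathcomp Require Export all_boot all_order all_algebra.
From mathcomp Require Export all_classical all_reals all_analysis.

Set Implicit Arguments.
Unset Strict Implicit.
Unset Printing Implicit Defensive.

Import Order.TTheory GRing.Theory Num.Theory.
Import numFieldNormedType.Exports.

Local Open Scope classical_set_scope.
Local Open Scope ring_scope.

(* Processes are indexed by all of R; their values are constrained only on
   [0, +oo[ (for B) and on [0, T[ (for X). *)

Section processes.
Context d (Omega : measurableType d) (R : realType) (P : probability Omega R).

Implicit Types B X : R -> {RV P >-> R}.

(* Taking some of the A i to be setT gives the product rule for subfamilies,
   so this is mutual independence of the increments over t 0 <= ... <= t n. *)
Definition independent_increments B : Prop :=
  forall (n : nat) (t : nat -> R) (A : nat -> set R),
    0 <= t 0%N -> {homo t : i j / (i <= j)%N >-> i <= j} ->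
    (forall i, measurable (A i)) ->
    P (\bigcap_(i in `I_n) ((B (t i.+1) \- B (t i)) @^-1` A i)) =
    (\prod_(i < n) P ((B (t i.+1) \- B (t i))%R @^-1` A i))%E.

(* The second parameter of normal_prob is the standard deviation. *)
Definition standard_wiener_process B : Prop :=
  [/\ {ae P, forall w, B 0 w = 0},
      independent_increments B,
      forall (s t : R) (A : set R), 0 <= s -> s < t -> measurable A ->
        pushforward P (B t \- B s) A = normal_prob 0 (Num.sqrt (t - s)) A
    & forall w, {within `[0, +oo[, continuous (fun t : R => B t w)}].

(* The usual augmentation of the filtration generated by B. It is a family of
   subsets of Omega, possibly not all in the sigma-algebra of Omega, since P is
   not assumed complete. *)
Definition wiener_events B (u : R) : set (set Omega) :=
  [set E | exists (s : R) (C : set R),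
     [/\ 0 <= s <= u, measurable C & E = B s @^-1` C]].

Definition augmented_filtration B (t : R) : set (set Omega) :=
  \bigcap_(u in [set u : R | t < u]) <<s wiener_events B u `|` P.-negligible >>.

(* Strong solution on [0, T[, with continuous paths, of
     dX_t = - alpha / (T - t) X_t dt + dB_t,  X_0 = 0.
   The diffusion coefficient is 1, so the stochastic integral in the integral
   form of the equation is B_t - B_0. *)
Definition bridge_strong_solution (alpha T : R) B X : Prop :=
  [/\ forall (t : R) (C : set R), 0 <= t < T -> measurable C ->
        augmented_filtration B t (X t @^-1` C),
      forall w, {within `[0, T[, continuous (fun t : R => X t w)},
      {ae P, forall w, X 0 w = 0}
    & {ae P, forall w, forall t : R, 0 <= t < T ->
        X t w = (\int[lebesgue_measure]_(s in `[0, t])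
                   (- (alpha / (T - s)) * X s w))
                + (B t w - B 0 w)}].

End processes.

(* Main.v *)
From HB Require Import structures.
Require Import Defs.
From mathcomp Require Import all_boot all_order all_algebra.
From mathcomp Require Import all_classical all_reals all_analysis.
From mathcomp Require Import measurable_realfun ring lra.

(** In the logarithmic time u = ln (1 / (T - t)), the process
    X_t / sqrt (T - t) is a Brownian motion.  Indeed the equation of X says
    that d(X_t / sqrt (T - t)) = dB_t / sqrt (T - t), the integral of a
    deterministic function: the increments are independent, Gaussian, centred,
    and the variance over [s, t] is the integral of 1 / (T - r), that is
    ln ((T - s) / (T - t)), the length of the interval in the time u.  Since
    the normalization of the theorem is sqrt (T - t) * sqrt (2 u ln (ln u)),
    the first part is the law of the iterated logarithm at +oo for
    W_u = X_t / sqrt (T - t), and the second part follows from the first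
    because sqrt (2 u ln (ln u)) tends to +oo.

    No stochastic integral is needed to find the law of W.  On almost every
    path the increments of W are limits of Riemann sums of
    dB_t / sqrt (T - t) (log_sum_cvg): the error over one cell is small with
    respect to the length of the cell, by the integral equation and the uniform
    continuity of the path (bridge_path_cell).  The cells have equal lengths
    in the time u and the sums are multiplied by a constant tending to 1, so
    that each sum has exactly the Gaussian law expected of the limit; this law
    comes from the convolution of Gaussian densities (normal_prob_conv), and
    the independence of the sums over disjoint blocks from the same argument
    (gauss_law_blocks).  Fatou's lemma for events then shows that the
    probability that the increments of W lie in given open sets is at most the
    product of the Gaussian measures of these sets (log_bridge_on_open).  This
    one-sided property, called brownian_on_open, is all that the law of the
    iterated logarithm uses.

    Upper bound (lil_upper_bound).  Along u_n = exp (s n), Gaussian tails and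
    the Borel-Cantelli lemma bound |W|.  Between u_n and u_(n+1) a dyadic
    chaining (dyadic_chaining) replaces a maximal inequality: it loses a
    universal constant, which is harmless because the oscillation it bounds
    becomes negligible when s tends to 0.

    Lower bound (lil_lower_bound).  Along u_n = D^(-n) with D small, the
    increments W_(u_(n+1)) - W_(u_n) exceed (1 - D) times the normalization
    infinitely often: the probability that this fails for all n >= N is at most
    a product of factors 1 - c / n, which is 0.  The term W_(u_n) is small with
    respect to the normalization at u_(n+1), by the upper bound.  The limit
    inferior is the case of -W.

    A statement about the probability of an event requires the event to be
    measurable.  By continuity of the paths, limits superior are determined by
    the values at rational u (measurable_exists_gt). *)
Set Implicit Arguments.
Unset Strict Implicit.
Unset Printing Implicit Defensive.

Import Order.TTheory GRing.Theory Num.Theory.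
Import numFieldNormedType.Exports.

Local Open Scope classical_set_scope.
Local Open Scope ring_scope.

(** * Gaussian laws *)

Section gaussian_laws.
Context {R : realType}.
Local Notation mu := (@lebesgue_measure R).

(** Both sides are measures in A which agree on bounded intervals. *)
Lemma lebesgue_measure_affine (c m : R) (A : set R) : 0 < c -> measurable A ->
  (c%:E * mu ((fun x => c * x + m)%R @^-1` A) = mu A)%E.
Proof.
move=> c0 mA.
have mF : measurable_fun setT (fun x : measurableTypeR R => c * x + m : measurableTypeR R).
  by apply: measurable_funD => //; exact: measurable_funM.
pose F := (fun x : measurableTypeR R => c * x + m : measurableTypeR R).
pose nu : {measure set (measurableTypeR R) -> \bar R} :=
  mscale (NngNum (ltW c0)) (pushforward mu F).
rewrite (@lebesgue_measure_unique R (nu mF) _ A mA)//.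
move=> _ [[a b]] _ <-; rewrite /nu /= /mscale /= /pushforward.
have -> : F @^-1` `]a, b] = `](a - m) / c, (b - m) / c]%classic.
  apply/seteqP; split => x /=; rewrite !in_itv/= ltr_pdivrMr// ler_pdivlMr// ltrBlDr lerBrDr
    mulrC.
    by [].
  by [].
rewrite !lebesgue_measure_itv/= !lte_fin ltr_pM2r ?invr_gt0// ltrD2r.
case: ifP => _; last by rewrite mule0.
by rewrite -!EFinD -EFinM; congr EFin; field; rewrite gt_eqF.
Qed.

Lemma normal_peakM (c s : R) : 0 < c -> normal_peak (c * s) = c^-1 * normal_peak s.
Proof.
move=> c0; rewrite /normal_peak exprMn -mulrA -mulrnAr sqrtrM ?sqr_ge0//.
by rewrite sqrtr_sqr gtr0_norm// invfM.
Qed.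

Lemma normal_pdf_affine (c m s x : R) : 0 < c -> 0 < s ->
  c * normal_pdf m (c * s) (c * x + m) = normal_pdf 0 s x.
Proof.
move=> c0 s0; rewrite !normal_pdfE ?gt_eqF ?mulr_gt0//.
rewrite normal_peakM// !mulrA divff ?gt_eqF// mul1r /normal_fun; congr (_ * expR _).
by rewrite addrK subr0 -mulr_natr -[in RHS]mulr_natr; field; rewrite !gt_eqF.
Qed.

(** The density of normal_prob is a Radon-Nikodym derivative, hence equal almost
    everywhere to the one produced by the general theory, for which the change
    of variables is known. *)
Lemma integral_normal_prob (m s : R) (f : measurableTypeR R -> \bar R) : s != 0 ->
  measurable_fun setT f -> (forall x, 0 <= f x)%E ->
  (\int[normal_prob m s]_x f x = \int[mu]_x (f x * (normal_pdf m s x)%:E))%E.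
Proof.
move=> s0 mf f0.
have dom := normal_prob_dominates m s.
rewrite -(Radon_Nikodym_SigmaFinite.change_of_variables dom)//.
apply: ae_eq_integral => //.
- apply: emeasurable_funM => //; apply: (measurable_int mu).
  exact: Radon_Nikodym_SigmaFinite.f_integrable.
- apply: emeasurable_funM => //=; apply/measurableT_comp => //=.
  exact: measurable_normal_pdf.
- apply: ae_eqe_mul2l => /=; apply: integral_ae_eq => //=.
  + exact: Radon_Nikodym_SigmaFinite.f_integrable.
  + by apply/measurableT_comp =>//; exact: measurable_normal_pdf.
  + by move=> E E01 mE; rewrite -Radon_Nikodym_SigmaFinite.f_integral.
Qed.

Lemma normal_prob_affine (c m s : R) (A : set R) : 0 < c -> 0 < s -> measurable A ->
  normal_prob 0 s ((fun x => c * x + m) @^-1` A) = normal_prob m (c * s) A.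
Proof.
move=> c0 s0 mA.
have mF : measurable_fun setT (fun x : measurableTypeR R => c * x + m : measurableTypeR R).
  by apply: measurable_funD => //; exact: measurable_funM.
pose F := (fun x : measurableTypeR R => c * x + m : measurableTypeR R).
have mpdf : measurable_fun A (fun x => (normal_pdf m (c * s) x)%:E).
  by apply/measurable_EFinP/measurable_funTS; exact: measurable_normal_pdf.
rewrite /normal_prob.
rewrite [RHS](_ : _ = \int[mscale (NngNum (ltW c0)) (pushforward mu F)]_(x in A) (normal_pdf m
  (c * s) x)%:E)%E; last first.
  apply: eq_measure_integral; by move=> /= E mE _; rewrite /mscale/= lebesgue_measure_affine.
rewrite ge0_integral_mscale//; last by move=> x _; rewrite lee_fin normal_pdf_ge0.
rewrite (ge0_integral_pushforward mF)//; last by move=> x _; rewrite lee_fin normal_pdf_ge0.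
rewrite -ge0_integralZl//.
- by apply: eq_integral => x _; rewrite /= -EFinM normal_pdf_affine.
- by rewrite -[X in measurable X]setTI; exact: mF.
- apply/measurable_EFinP; apply: measurable_funTS; apply: measurableT_comp => //.
  exact: measurable_normal_pdf.
- by move=> x _; rewrite lee_fin normal_pdf_ge0.
Qed.

Lemma normal_probN (s : R) (A : set R) : s != 0 -> measurable A ->
  normal_prob 0 s (-%R @^-1` A) = normal_prob 0 s A.
Proof.
move=> s0 mA.
have mpdf : measurable_fun A (fun x => (normal_pdf 0 s x)%:E).
  by apply/measurable_EFinP/measurable_funTS; exact: measurable_normal_pdf.
rewrite [RHS]/normal_prob.
rewrite [RHS](_ : _ = \int[pushforward mu (-%R : measurableTypeR R -> measurableTypeR R)]_(x in
  A) (normal_pdf 0 s x)%:E)%E; last first.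
  apply: eq_measure_integral; by move=> /= E mE _; apply/esym; exact: lebesgue_measureN.
have mN : measurable_fun setT (-%R : measurableTypeR R -> measurableTypeR R).
  exact: oppr_measurable.
rewrite (ge0_integral_pushforward mN mu mA mpdf); last by move=> x _;
  rewrite lee_fin normal_pdf_ge0.
by apply: eq_integral => x _; rewrite /= !normal_pdfE// /normal_fun !subr0 sqrrN.
Qed.

(** Completing the square in x: the joint density of a centred Gaussian variable
    and of its sum with an independent one is the density of the sum times the
    conditional density of the first variable, which is again Gaussian. *)
Lemma normal_pdf_conv (a b c x y : R) : 0 < a -> 0 < b -> 0 < c ->
  c ^+ 2 = a ^+ 2 + b ^+ 2 ->
  normal_pdf 0 a x * normal_pdf x b y =
  normal_pdf 0 c y * normal_pdf (y * (a / c) ^+ 2) (a * b / c) x.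
Proof.
move=> a0 b0 c0 cE.
rewrite !normal_pdfE ?gt_eqF ?divr_gt0 ?mulr_gt0// mulrACA [RHS]mulrACA; congr (_ * _).
- rewrite /normal_peak -!invfM -!sqrtrM ?mulrn_wge0 ?mulr_ge0 ?sqr_ge0 ?pi_ge0 ?(ltW c0) ?(ltW
  a0) ?(ltW b0)//.
  congr (Num.sqrt _)^-1.
  by field; rewrite gt_eqF.
- rewrite /normal_fun -!expRD; congr expR.
  have c20 : 0 < a ^+ 2 + b ^+ 2 by rewrite addr_gt0// exprn_gt0.
  by rewrite !expr_div_n cE; field; rewrite !gt_eqF.
Qed.

Lemma measurable_normal_pdf2 (b : R) : b != 0 ->
  measurable_fun setT (fun xy : measurableTypeR R * measurableTypeR R => normal_pdf xy.1 b xy.2).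
Proof.
move=> b0.
rewrite (_ : (fun _ => _) = fun xy : measurableTypeR R * measurableTypeR R =>
  normal_peak b * normal_fun 0 b (xy.2 - xy.1)).
  apply: measurable_funM => //.
  apply: (measurableT_comp (measurable_normal_fun 0 b)).
  by apply: measurable_funB; [exact: measurable_snd|exact: measurable_fst].
by apply/funext => -[x y] /=; rewrite normal_pdfE// /normal_fun subr0.
Qed.

(** By Fubini, the law of the sum has density the integral over x of the left-hand
    side of normal_pdf_conv; the conditional density integrates to 1. *)
Lemma normal_prob_conv (a b : R) (C : set R) : 0 < a -> 0 < b -> measurable C ->
  (normal_prob 0 a \x normal_prob 0 b)%E [set xy | C (xy.1 + xy.2)] =
  normal_prob 0 (Num.sqrt (a ^+ 2 + b ^+ 2)) C.
Proof.
move=> a0 b0 mC.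
have c0 : 0 < a ^+ 2 + b ^+ 2 by rewrite addr_gt0// exprn_gt0.
have sc0 : 0 < Num.sqrt (a ^+ 2 + b ^+ 2) by rewrite sqrtr_gt0.
have mC1 : measurable_fun setT (fun xy : measurableTypeR R * measurableTypeR R => \1_C xy.2 : R).
  apply: (measurableT_comp (f := \1_C : measurableTypeR R -> R)); last exact: measurable_snd.
  exact: measurable_indic.
have mb : measurable_fun setT (fun xy : measurableTypeR R * measurableTypeR R =>
    (\1_C xy.2 * normal_pdf xy.1 b xy.2)%:E).
  by apply/measurable_EFinP; apply: measurable_funM => //; apply: measurable_normal_pdf2;
    rewrite gt_eqF.
have mab : measurable_fun setT (fun xy : measurableTypeR R * measurableTypeR R =>
    (\1_C xy.2 * (normal_pdf 0 a xy.1 * normal_pdf xy.1 b xy.2))%:E).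
  apply/measurable_EFinP; apply: measurable_funM => //; apply: measurable_funM.
    by apply: (measurableT_comp (measurable_normal_pdf 0 a)); exact: measurable_fst.
  by apply: measurable_normal_pdf2; rewrite gt_eqF.
have NE x : normal_prob x b C = (\int[mu]_y (\1_C y * normal_pdf x b y)%:E)%E.
  rewrite /normal_prob integral_mkcond; apply: eq_integral => y _.
  by rewrite patchE indicE; case: ifP => _; rewrite ?mul1r ?mul0r.
have i0 y : 0 <= \1_C y :> R by rewrite indicE.
rewrite /product_measure1.
transitivity (\int[normal_prob 0 a]_x normal_prob x b C)%E.
  apply: eq_integral => x _; rewrite -[in RHS](mul1r b) -normal_prob_affine//=.
  by congr normal_prob; apply/seteqP; split => y /=; rewrite /xsection/= inE/= mul1r addrC.
rewrite integral_normal_prob ?gt_eqF//; last first.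
  under eq_fun do rewrite NE.
  apply: (@measurable_fun_fubini_tonelli_F _ _ _ _ _ mu (fun xy => (\1_C xy.2 * normal_pdf xy.1
    b xy.2)%:E)) => //.
  by move=> xy; rewrite lee_fin mulr_ge0// normal_pdf_ge0.
transitivity (\int[mu]_x \int[mu]_y (\1_C y * (normal_pdf 0 a x * normal_pdf x b y))%:E)%E.
  apply: eq_integral => x _; rewrite NE muleC -ge0_integralZl//.
  - by apply: eq_integral => y _; rewrite -EFinM mulrCA.
  - apply/measurable_EFinP; apply: measurable_funM => //; exact: measurable_normal_pdf.
  - by move=> y _; rewrite lee_fin mulr_ge0// normal_pdf_ge0.
  - by rewrite lee_fin normal_pdf_ge0.
rewrite (@fubini_tonelli _ _ _ _ _ mu mu (fun xy => (\1_C xy.2 * (normal_pdf 0 a xy.1 *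
  normal_pdf xy.1 b xy.2))%:E)%E)//=; last first.
  by move=> xy; rewrite lee_fin !mulr_ge0// normal_pdf_ge0.
rewrite /normal_prob [RHS]integral_mkcond; apply: eq_integral => y _.
under eq_integral do rewrite (normal_pdf_conv _ _ a0 b0 sc0 (sqr_sqrtr (ltW c0))) mulrA EFinM.
rewrite ge0_integralZl//=.
- rewrite integral_normal_pdf mule1 patchE indicE.
  by case: ifP => _; rewrite ?mul1r// mul0r.
- apply/measurable_EFinP; exact: measurable_normal_pdf.
- by move=> x _; rewrite lee_fin normal_pdf_ge0.
- by rewrite lee_fin mulr_ge0// normal_pdf_ge0.
Qed.

(** For x > a >= 0, x^2 >= a^2 + (x - a)^2, so the density at x is at most
    exp (- a^2 / 2 s^2) times the density of the Gaussian law centred at a. *)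
Lemma normal_ray_le (s a : R) : 0 < s -> 0 <= a ->
  (normal_prob 0 s `]a, +oo[ <= (expR (- (a ^+ 2 / (s ^+ 2 *+ 2))))%:E)%E.
Proof.
move=> s0 a0.
have mA : measurable (`]a, +oo[%classic : set (measurableTypeR R)) by exact: measurable_itv.
pose e := expR (- (a ^+ 2 / (s ^+ 2 *+ 2))).
apply: (@le_trans _ _ (\int[mu]_(x in `]a, +oo[) (e%:E * (normal_pdf a s x)%:E))%E).
  apply: ge0_le_integral => //=.
  - by move=> x _; rewrite lee_fin normal_pdf_ge0.
  - by apply/measurable_funTS/measurable_EFinP; exact: measurable_normal_pdf.
  - by apply/measurable_funTS/measurable_EFinP; apply: measurable_funM => //;
    exact: measurable_normal_pdf.
  move=> x; rewrite in_itv/= andbT => ax;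
    rewrite lee_fin !normal_pdfE ?gt_eqF// mulrCA ler_wpM2l ?normal_peak_ge0//.
  rewrite /normal_fun -expRD ler_expR -subr_ge0.
  rewrite (_ : _ - _ = 2 * a * (x - a) / (s ^+ 2 *+ 2)); last by field; rewrite gt_eqF.
  by rewrite divr_ge0 ?mulr_ge0 ?mulrn_wge0 ?sqr_ge0// subr_ge0 ltW.
rewrite ge0_integralZl//=.
- rewrite -[leRHS]mule1 lee_pmul2l ?lte_fin ?expR_gt0//.
  exact: (@probability_le1 _ _ _ (normal_prob a s)).
- by apply/measurable_funTS/measurable_EFinP; exact: measurable_normal_pdf.
- by move=> x _; rewrite lee_fin normal_pdf_ge0.
- by rewrite lee_fin expR_ge0.
Qed.

(** The density is at least its value at a + s on [a, a + s]. *)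
Lemma normal_ray_ge (s a : R) : 0 < s -> 0 <= a ->
  (((Num.sqrt (pi *+ 2))^-1 * expR (- ((a / s + 1) ^+ 2 / 2)))%:E <=
   normal_prob 0 s `[a, +oo[)%E.
Proof.
move=> s0 a0.
have mA : measurable (`[a, a + s]%classic : set (measurableTypeR R)) by exact: measurable_itv.
have mB : measurable (`[a, +oo[%classic : set (measurableTypeR R)) by exact: measurable_itv.
apply: (@le_trans _ _ (normal_prob 0 s `[a, a + s])); last first.
  apply: le_measure; rewrite ?inE//.
  by move=> x /=; rewrite !in_itv/= => /andP[->].
pose k := (normal_pdf 0 s (a + s))%:E.
apply: (@le_trans _ _ (\int[mu]_(x in `[a, (a + s)%R]) k)%E).
  rewrite integral_cst//= lebesgue_measure_itv/= lte_fin ltrDl s0 -EFinD addrAC subrr add0r.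
  rewrite /k -EFinM lee_fin normal_pdfE ?gt_eqF// /normal_peak /normal_fun.
  rewrite -mulrnAr sqrtrM ?sqr_ge0// sqrtr_sqr gtr0_norm// invfM.
  have : 0 < Num.sqrt (pi *+ 2) :> R by rewrite sqrtr_gt0 mulrn_wgt0// pi_gt0.
  move: (Num.sqrt _) => p p0; set E := expR (_ / (_ *+ 2)).
  have -> : s^-1 / p * E * s = p^-1 * E by field; rewrite !gt_eqF.
  rewrite le_eqVlt; apply/orP; left; apply/eqP; congr (_ * expR _).
  by field; rewrite gt_eqF.
apply: ge0_le_integral => //=.
- by move=> x _; rewrite lee_fin normal_pdf_ge0.
- by apply/measurable_funTS/measurable_EFinP; exact: measurable_normal_pdf.
move=> x; rewrite in_itv/= => /andP[ax xas].
rewrite lee_fin !normal_pdfE ?gt_eqF// ler_wpM2l ?normal_peak_ge0//.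
rewrite /normal_fun ler_expR !subr0 !mulNr lerN2 ler_wpM2r ?invr_ge0 ?mulrn_wge0 ?sqr_ge0//.
by rewrite ler_sqr// nnegrE; [exact: le_trans a0 ax|rewrite addr_ge0// ltW].
Qed.

(** The lower bound on Gaussian tails in the form that fits the iterated
    logarithm: at a level x with x^2 = 2 (1 - D) l sg^2, the factor 1 - D absorbs
    the loss in normal_ray_ge and leaves exp (- l) up to a constant depending on
    D only. *)
Lemma normal_prob_ray_le (l sg D x : R) : 0 < D -> D < 1 -> 0 < l -> 0 < sg -> 0 <= x ->
  x ^+ 2 = 2 * (1 - D) * l * sg ^+ 2 ->
  (normal_prob 0 sg `]-oo, x[ <=
   (1 - (Num.sqrt (pi *+ 2))^-1 * expR (- ((1 + D^-1) / 2)) * expR (- l))%:E)%E.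
Proof.
move=> D0 D1 l0 sg0 x0 xE.
have mI (i : interval R) : measurable ([set` i] : set (measurableTypeR R)) by exact:
  measurable_itv.
have -> : `]-oo, x[%classic = ~` `[x, +oo[%classic by rewrite setCitvr.
rewrite probability_setC//.
set z := x / sg.
have z2 : z ^+ 2 = 2 * (1 - D) * l by rewrite expr_div_n xE mulfK// expf_neq0// gt_eqF.
rewrite EFinB leeD2lE// leeN2; apply: le_trans (normal_ray_ge sg0 x0).
rewrite lee_fin -mulrA ler_pM2l; last by rewrite invr_gt0 sqrtr_gt0 mulrn_wgt0// pi_gt0.
rewrite -expRD ler_expR -opprD lerN2 -/z.
(* This is the inequality 2 z <= D z^2 + 1 / D, with its remainder. *)
have -> : (z + 1) ^+ 2 = (1 + D) * z ^+ 2 + (1 + D^-1) - D * (z - D^-1) ^+ 2.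
  by field; rewrite gt_eqF.
rewrite z2.
have : 0 <= D * (z - D^-1) ^+ 2 by rewrite mulr_ge0 ?sqr_ge0// ltW.
have : 0 <= D ^+ 2 * l by rewrite mulr_ge0 ?sqr_ge0// ltW.
by move: (D * (z - D^-1) ^+ 2) (D^-1) => y1 y2; lra.
Qed.

End gaussian_laws.

(** * Finite families of independent Gaussian variables *)

Section independent_gaussians.
Context d (Omega : measurableType d) (R : realType) (P : probability Omega R).

(** Each Y of the list s is a variable and a standard deviation.  The event E and
    the number c accumulate the constraints on the variables already consumed and
    the product of their Gaussian measures, so that gauss_law s setT 1 says that
    the variables of s are independent centred Gaussian variables.  The recursive
    form lets two consecutive variables be replaced by their sum without any
    bookkeeping of indices. *)
Fixpoint gauss_law (s : seq ((Omega -> R) * R)) (E : set Omega) (c : \bar R) : Prop :=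
  if s is Y :: s' then
    [/\ measurable_fun setT Y.1, 0 < Y.2 & forall A : set R, measurable A ->
        gauss_law s' (E `&` Y.1 @^-1` A) (c * normal_prob 0 Y.2 A)%E]
  else P E = c.

Definition gauss_add (Y Z : (Omega -> R) * R) : (Omega -> R) * R :=
  (Y.1 \+ Z.1, Num.sqrt (Y.2 ^+ 2 + Z.2 ^+ 2)).

(** The law of (Y, Z) restricted to E is c times a product of Gaussian laws on
    rectangles, hence on all measurable sets of the plane. *)
Lemma gauss_law2_add (Y Z : Omega -> R) (a b : R) (E : set Omega) (c : \bar R) (C : set R) :
  measurable_fun setT Y -> measurable_fun setT Z -> measurable E ->
  0 < a -> 0 < b -> measurable C ->
  (forall A B : set R, measurable A -> measurable B ->
    P (E `&` Y @^-1` A `&` Z @^-1` B) = c * normal_prob 0 a A * normal_prob 0 b B)%E ->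
  P (E `&` (Y \+ Z) @^-1` C) = (c * normal_prob 0 (Num.sqrt (a ^+ 2 + b ^+ 2)) C)%E.
Proof.
move=> mY mZ mE a0 b0 mC PE.
have PEc : P E = c.
  have := PE setT setT measurableT measurableT.
  by rewrite !preimage_setT !setIT !probability_setT !mule1.
have mYZ : measurable_fun setT (fun w => (Y w, Z w) : measurableTypeR R * measurableTypeR R).
  exact: measurable_fun_pair.
have mYZC : measurable ((Y \+ Z) @^-1` C).
  by rewrite -[X in measurable X]setTI; apply: measurable_funD.
(* The product measure is compared with a measure normalized by 1 / c. *)
have [c0|c0] := eqVneq c 0%E.
  rewrite c0 mul0e; apply/eqP; rewrite eq_le measure_ge0 andbT -c0 -PEc.
  by apply: le_measure; rewrite ?inE//; exact: measurableI.
have cfin : c \is a fin_num by rewrite -PEc; exact: fin_num_measure.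
have cge0 : (0 <= c)%E by rewrite -PEc.
have fc0 : 0 < fine c by rewrite fine_gt0// lt0e c0 cge0 ltey_eq cfin.
have fc1 : 0 <= (fine c)^-1 by rewrite invr_ge0 ltW.
pose m' : {measure set (measurableTypeR R * measurableTypeR R) -> \bar R} :=
  mscale (NngNum fc1) (pushforward (mrestr P mE) (fun w => (Y w, Z w) : measurableTypeR R *
    measurableTypeR R)).
have := @product_measure_unique _ _ _ _ _ (normal_prob 0 a) (normal_prob 0 b) (m' mYZ) _
  [set xy | C (xy.1 + xy.2)].
rewrite normal_prob_conv// => ->.
- rewrite /m' /= /mscale/= /pushforward/= /mrestr -[X in (X * _)%E]fineK// muleA -EFinM.
  by rewrite divff ?gt_eqF// mul1e setIC.
- move=> A B mA mB; rewrite /m' /= /mscale/= /pushforward/= /mrestr.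
  have -> : (fun w => (Y w, Z w)) @^-1` (A `*` B) `&` E = E `&` Y @^-1` A `&` Z @^-1` B.
    by apply/seteqP; split => w /= [] => [[]|[]].
  rewrite PE// -[X in (_ * (X * _ * _))%E]fineK// !muleA -EFinM mulVf ?gt_eqF//.
  by rewrite mul1e.
- have mD : measurable_fun setT (fun xy : measurableTypeR R * measurableTypeR R => xy.1 + xy.2).
    by apply: measurable_funD; [exact: measurable_fst|exact: measurable_snd].
  by rewrite -[X in measurable X]setTI; apply: mD.
Qed.

(** The constraints on the variables that follow Y and Z go into E, which reduces
    the lemma to gauss_law2_add. *)
Lemma gauss_law_merge Y Z s E c : measurable E ->
  gauss_law [:: Y, Z & s] E c -> gauss_law (gauss_add Y Z :: s) E c.
Proof.
move=> mE /= [mY Y0 YZs].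
have [mZ Z0 _] := YZs _ measurableT.
have YZ A B (mA : measurable A) (mB : measurable B) :
    gauss_law s (E `&` Y.1 @^-1` A `&` Z.1 @^-1` B)
      (c * normal_prob 0 Y.2 A * normal_prob 0 Z.2 B)%E.
  by have [_ _] := YZs _ mA; exact.
split => [||C mC]; first exact: measurable_funD.
  by rewrite sqrtr_gt0 addr_gt0// exprn_gt0.
elim: s E c mE YZ {YZs} => [|U s IH] E c mE /= YZ; first exact: gauss_law2_add.
have [mU U0 _] := YZ _ _ measurableT measurableT.
split => // D mD; rewrite setIAC muleAC; apply: IH.
  by apply: measurableI => //; rewrite -[X in measurable X]setTI; exact: mU.
move=> A B mA mB; have [_ _ /(_ _ mD) H] := YZ _ _ mA mB.
have -> : E `&` U.1 @^-1` D `&` Y.1 @^-1` A `&` Z.1 @^-1` B =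
          E `&` Y.1 @^-1` A `&` Z.1 @^-1` B `&` U.1 @^-1` D.
  by rewrite (setIAC E) [LHS]setIAC.
rewrite [X in gauss_law _ _ X](_ : _ =
  (c * normal_prob 0 Y.2 A * normal_prob 0 Z.2 B * normal_prob 0 U.2 D)%E); last first.
  by rewrite [RHS]muleAC [in RHS](muleAC c).
exact: H.
Qed.

Lemma gauss_law_sum Y l s E c : measurable E ->
  gauss_law (Y :: l ++ s) E c -> gauss_law (foldl gauss_add Y l :: s) E c.
Proof.
move=> mE; elim: l Y => [//|Z l IH] Y /= H; apply: IH.
exact: (@gauss_law_merge _ _ (l ++ s)).
Qed.

Lemma gauss_law_blocks (I : Type) (r : seq I) (Y : I -> (Omega -> R) * R)
    (l : I -> seq ((Omega -> R) * R)) E c : measurable E ->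
  gauss_law (flatten [seq Y i :: l i | i <- r]) E c ->
  gauss_law [seq foldl gauss_add (Y i) (l i) | i <- r] E c.
Proof.
elim: r E c => [//|i r IH] E c mE /=.
move=> /(gauss_law_sum mE)[mY Y0 H]; split => // A mA.
by apply: IH (H _ mA); apply: measurableI => //; rewrite -[X in measurable X]setTI; exact: mY.
Qed.

Lemma foldl_gauss_add (Y : (Omega -> R) * R) (l : seq ((Omega -> R) * R)) : 0 <= Y.2 ->
  foldl gauss_add Y l = ((fun w => Y.1 w + \sum_(Z <- l) Z.1 w),
    Num.sqrt (Y.2 ^+ 2 + \sum_(Z <- l) Z.2 ^+ 2)).
Proof.
elim: l Y => [|Z l IH] Y Y0 /=.
  rewrite big_nil addr0 sqrtr_sqr ger0_norm//.
  by case: Y {Y0} => Y y; congr pair; apply/funext => w; rewrite big_nil addr0.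
rewrite IH ?sqrtr_ge0//; congr pair.
  by apply/funext => w; rewrite big_cons addrA.
by rewrite big_cons addrA /= sqr_sqrtr// addr_ge0// sqr_ge0.
Qed.

(** Links the recursive form with the product rule for the intersection of all
    constraints; taking E and c general makes the induction go through. *)
Lemma gauss_law_mkseqP (f : nat -> (Omega -> R) * R) m n E c :
  (forall i, measurable_fun setT (f i).1 /\ 0 < (f i).2) ->
  gauss_law [seq f i | i <- iota m n] E c <->
  (forall A : nat -> set R, (forall i, measurable (A i)) ->
    P (E `&` \bigcap_(i in [set i | (m <= i < m + n)%N]) (f i).1 @^-1` A i) =
    (c * \prod_(m <= i < m + n) normal_prob 0 (f i).2 (A i))%E).
Proof.
move=> mf; elim: n m E c => [|n IH] m E c.
  have -> : [set i | (m <= i < m + 0)%N] = set0.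
    by apply/seteqP; split => // i /=; rewrite addn0; case: leqP.
  rewrite /= addn0; split => [<- A mA|/(_ (fun _ => setT))].
    by rewrite bigcap_set0 setIT big_geq// mule1.
  by rewrite bigcap_set0 setIT big_geq// mule1; apply.
have capE (A : nat -> set R) :
    E `&` \bigcap_(i in [set i | (m <= i < m + n.+1)%N]) (f i).1 @^-1` A i =
    (E `&` (f m).1 @^-1` A m) `&`
    \bigcap_(i in [set i | (m.+1 <= i < m.+1 + n)%N]) (f i).1 @^-1` A i.
  rewrite addSnnS; apply/seteqP; split => w /=.
    move=> [Ew H]; split; last first.
      by move=> i /= /andP[mi im]; apply: H => /=; rewrite ltnW.
    by split => //; apply: H => /=; rewrite leqnn addnS ltnS leq_addr.
  move=> [[Ew Aw] H]; split => // i /= /andP[]; rewrite leq_eqVlt => /orP[/eqP <-//|mi im].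
  by apply: H; rewrite /= mi.
split => [/= [_ _ H] A mA|H /=].
  have /IH := H _ (mA m); rewrite capE => ->//.
  by rewrite [in RHS]big_ltn ?muleA ?addnS ?ltnS ?leq_addr.
have [mm m0] := mf m; split => // A0 mA0; apply/IH => A mA.
pose A' i := if i == m then A0 else A i.
have := H A'; rewrite capE big_ltn ?addnS ?ltnS ?leq_addr// muleA /A' eqxx.
have -> : \bigcap_(i in [set i | (m.+1 <= i < m.+1 + n)%N]) (f i).1 @^-1` (if i == m then A0
  else A i) =
   \bigcap_(i in [set i | (m.+1 <= i < m.+1 + n)%N]) (f i).1 @^-1` A i.
  by apply: eq_bigcapr => i /= /andP[mi _]; rewrite gtn_eqF.
move=> ->; last by move=> i; case: ifP.
by congr (_ * _)%E; apply: eq_big_nat => i /andP[mi _]; rewrite gtn_eqF.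
Qed.

End independent_gaussians.

Lemma flatten_iota (T : Type) (f : nat -> T) n N :
  flatten [seq [seq f (k * N + j)%N | j <- iota 0 N] | k <- iota 0 n] =
  [seq f i | i <- iota 0 (n * N)].
Proof.
elim: n => [//|n IH].
rewrite -[n.+1]addn1 iotaD map_cat flatten_cat IH mulnDl mul1n [in RHS]iotaD map_cat /= cats0
  add0n; congr cat.
by rewrite add0n -[in RHS](addn0 (n * N)%N) iotaDl -map_comp.
Qed.

(** * Paths of the bridge equation *)

Section sde_riemann_sums.
Context {R : realType}.
Local Notation mu := (@lebesgue_measure R).

Lemma within_continuous_dist (A : set R) (f : R -> R) (x e : R) :
  {within A, continuous f} -> A x -> 0 < e ->
  exists2 r : R, 0 < r & forall y : R, A y -> `|x - y| < r -> `|f x - f y| < e.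
Proof.
move=> /subspace_continuousP/(_ x) cf Ax e0.
have /cvgrPdist_lt/(_ _ e0) := cf Ax.
rewrite near_withinE => -[r /= r0 H]; exists r => // y Ay xy.
exact: H.
Qed.

(** Heine-Cantor, from the characterization of compactness by near_covering applied
    to the filter of small positive radii. *)
Lemma segment_unif_continuous (f : R -> R) (a b e : R) :
  {within `[a, b], continuous f} -> 0 < e ->
  exists2 r : R, 0 < r & forall x y : R, `[a, b]%classic x -> `[a, b]%classic y ->
    `|x - y| < r -> `|f x - f y| < e.
Proof.
move=> cf e0.
have /compact_near_coveringP cab := @segment_compact R a b.
pose Q (r x : R) := forall y : R, `[a, b]%classic x -> `[a, b]%classic y ->
    `|x - y| < r -> `|f x - f y| < e.
have : \forall r \near (0:R)^'+, `[a, b]%classic `<=` Q r.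
  apply: cab => x abx.
  have [r r0 H] := within_continuous_dist cf abx (divr_gt0 e0 (ltr0n _ 2)).
  near=> y s => z aby abz yz.
  have xy : `|x - y| < r / 2 by near: y; apply: nbhsx_ballx; rewrite divr_gt0.
  have sr : s < r / 2 by near: s; apply: nbhs_right_lt; rewrite divr_gt0.
  rewrite (splitr e) -(subrKA (f x)) (le_lt_trans (ler_normD _ _))// ltrD//.
    by rewrite distrC; apply: H => //; rewrite (lt_trans xy)// ltr_pdivrMr// ltr_pMr// ltr1n.
  apply: H => //; rewrite (splitr r) -(subrKA y) (le_lt_trans (ler_normD _ _))// ltrD//.
  exact: lt_trans yz sr.
case=> r /= r0 H; exists (r / 2); first by rewrite divr_gt0.
move=> x y abx aby; apply: H => //=.
  by rewrite sub0r normrN gtr0_norm ?divr_gt0// ltr_pdivrMr// ltr_pMr// ltr1n.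
by rewrite divr_gt0.
Unshelve. all: by end_near. Qed.

Lemma Rintegral_itv_near_cst (f : R -> R) (V s t c e : R) : 0 <= s -> s <= t -> t <= V ->
  {within `[0, V], continuous f} ->
  (forall r, s <= r <= t -> `|f r - c| <= e) ->
  `|\int[mu]_(r in `[0, t]) f r - \int[mu]_(r in `[0, s]) f r - c * (t - s)| <= e * (t - s).
Proof.
move=> s0 st tV cf fc.
have int (u : R) : u <= V -> mu.-integrable `[0, u] (EFin \o f).
  move=> uV; apply: continuous_compact_integrable; first exact: segment_compact.
  by apply: continuous_subspaceW cf; apply: subset_itvl; rewrite bnd_simp.
rewrite Rintegral_itvB ?bnd_simp//; last exact: int.
have intst : mu.-integrable `]s, t] (EFin \o f).
  by apply: integrableS (int _ tV) => //; apply: subset_itvr; rewrite bnd_simp.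
have icst (k : R) : mu.-integrable `]s, t] (EFin \o cst k).
  have ck : mu.-integrable `[s, t] (EFin \o (cst k : R -> R)).
    apply: continuous_compact_integrable; first exact: segment_compact.
    by apply: continuous_subspaceT => ?; exact: cvg_cst.
  by apply: integrableS ck => //; apply: subset_itvr; rewrite bnd_simp.
have cstE (k : R) : \int[mu]_(r in `]s, t]) k = k * (t - s).
  rewrite Rintegral_cst//= lebesgue_measure_itv/= lte_fin.
  by move: st; rewrite le_eqVlt => /orP[/eqP ->|-> //]; rewrite ltxx subrr.
rewrite ler_norml; apply/andP; split.
- rewrite lerBrDr addrC -mulrBl -cstE; apply: le_Rintegral => //; try exact: icst; move=> r.
  rewrite /= in_itv/= => /andP[/ltW sr rt].
  by have := fc r; rewrite sr rt ler_norml lerBrDr addrC => /(_ isT)/andP[].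
- rewrite lerBlDr -mulrDl -cstE; apply: le_Rintegral => //; try exact: icst; move=> r.
  rewrite /= in_itv/= => /andP[/ltW sr rt].
  by have := fc r; rewrite sr rt ler_norml lerBlDr => /(_ isT)/andP[].
Qed.

(** The equation of bridge_strong_solution, for alpha = 1/2, along one path x of X
    and the corresponding path b of B. *)
Definition bridge_path (T : R) (x b : R -> R) := forall t : R, 0 <= t < T ->
  x t = \int[mu]_(s in `[0, t]) (- (2^-1 / (T - s)) * x s) + (b t - b 0).

(** The equality d(x / sqrt (T - t)) = db / sqrt (T - t) over one cell [s, t], up
    to o(t - s) uniformly.  With a and c the square roots of T - s and T - t, and K
    the integrand of the equation, the error is exactly the difference of
    (int_s^t K - K t (t - s)) / a, small by uniform continuity of K, and of the
    second order term x t (a - c)^2 / (2 a c^2). *)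
Lemma bridge_path_cell (T : R) (x b : R -> R) (V e : R) : 0 <= V < T ->
  {within `[0, T[, continuous x} -> bridge_path T x b -> 0 < e ->
  exists2 r : R, 0 < r & forall s t : R, 0 <= s -> s <= t -> t <= V -> t - s < r ->
   `|x t / Num.sqrt (T - t) - x s / Num.sqrt (T - s) - (b t - b s) / Num.sqrt (T - s)|
    <= e * (t - s).
Proof.
move=> /andP[V0 VT] cx Hx e0.
have cxV : {within `[0, V], continuous x}.
  by apply: continuous_subspaceW cx; apply: subset_itvl; rewrite bnd_simp.
pose K s := - (2^-1 / (T - s)) * x s.
have cK : {within `[0, V], continuous K}.
  apply/subspace_continuousP => s sV; apply: cvgM.
    apply: cvg_within_filter; apply: cvgN; apply: cvgM; first exact: cvg_cst.
    apply: cvgV; last by apply: cvgB; [exact: cvg_cst|exact: cvg_id].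
    by move: sV; rewrite /= in_itv/= => /andP[_ sV]; rewrite gt_eqF// subr_gt0 (le_lt_trans sV).
  by move/subspace_continuousP: cxV; exact.
have [M M0 HM] : exists2 M : R, 0 < M & forall t : R, 0 <= t <= V -> `|x t| <= M.
  have cn : {within `[0, V], continuous (Num.norm \o x)}.
    apply: within_continuous_comp cxV => ? _; exact: norm_continuous.
  have [c _ Hc] := EVT_max V0 cn.
  exists (`|x c| + 1); first by rewrite ltr_wpDl.
  by move=> t tV; rewrite (le_trans (Hc t _))//= lerDl.
pose m := Num.sqrt (T - V).
have m0 : 0 < m by rewrite sqrtr_gt0 subr_gt0.
have [r1 r10 H1] := segment_unif_continuous cK (mulr_gt0 (divr_gt0 e0 (ltr0n _ 2)) m0).
pose q := M / (8 * m ^+ 5).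
have q0 : 0 < q by rewrite divr_gt0// mulr_gt0// exprn_gt0.
exists (Num.min r1 (e / 2 / q)); first by rewrite lt_min r10 (divr_gt0 (divr_gt0 e0 _) q0).
move=> s t s0 st tV; rewrite lt_min => /andP[str1 stq].
have sT : s < T by rewrite (le_lt_trans _ VT)// (le_trans st).
have tT : t < T by rewrite (le_lt_trans _ VT).
have := Rintegral_itv_near_cst s0 st tV cK (c := K t) (e := e / 2 * m).
have -> : \int[mu]_(r in `[0, t]) K r - \int[mu]_(r in `[0, s]) K r =
   x t - x s - (b t - b s).
  rewrite (Hx t) ?(Hx s) ?s0 ?(le_trans s0 st)//. rewrite /K; ring.
set D := x t - x s - (b t - b s) => HD.
have {}HD : `|D - K t * (t - s)| <= e / 2 * m * (t - s).
  apply: HD => r /andP[sr rt]; apply/ltW/H1; rewrite /= ?in_itv/=.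
  - by rewrite (le_trans s0 sr) (le_trans rt).
  - by rewrite (le_trans s0 st).
  - by rewrite distrC ger0_norm ?subr_ge0// (le_lt_trans _ str1)// lerD2l lerN2.
set a := Num.sqrt (T - s); set c := Num.sqrt (T - t).
have c0 : 0 < c by rewrite sqrtr_gt0 subr_gt0.
have a0 : 0 < a by rewrite sqrtr_gt0 subr_gt0.
have mc : m <= c by rewrite ler_wsqrtr// lerD2l lerN2.
have ca : c <= a by rewrite ler_wsqrtr// lerD2l lerN2.
have aE : a ^+ 2 = T - s by rewrite sqr_sqrtr// subr_ge0 ltW.
have cE : c ^+ 2 = T - t by rewrite sqr_sqrtr// subr_ge0 ltW.
have tsE : t - s = (a - c) * (a + c) by rewrite -subr_sqr aE cE; ring.
have KE : K t = - (2^-1 / c ^+ 2) * x t by rewrite /K cE.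
have -> : x t / c - x s / a - (b t - b s) / a =
   (D - K t * (t - s)) / a - x t * ((a - c) ^+ 2 / (2 * a * c ^+ 2)).
  by rewrite KE tsE /D; field; rewrite !gt_eqF.
rewrite [leRHS](_ : _ = e / 2 * (t - s) + e / 2 * (t - s)); last by rewrite -mulrDl -splitr.
rewrite (le_trans (ler_normB _ _))// lerD//.
  rewrite normrM normfV (gtr0_norm a0) ler_pdivrMr// (le_trans HD)//.
  rewrite [leRHS]mulrAC ler_wpM2r ?subr_ge0// ler_wpM2l ?(le_trans mc)//.
  by rewrite divr_ge0// ltW.
have ac : a - c <= (t - s) / (2 * m).
  rewrite ler_pdivlMr ?mulr_gt0// tsE ler_wpM2l ?subr_ge0//.
  by rewrite mulr2n mulrDl mul1r lerD// (le_trans mc).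
have {}ac : (a - c) ^+ 2 / (2 * a * c ^+ 2) <= (t - s) ^+ 2 / (8 * m ^+ 5).
  have -> : (t - s) ^+ 2 / (8 * m ^+ 5) = ((t - s) / (2 * m)) ^+ 2 / (2 * m * m ^+ 2).
    by field; rewrite gt_eqF.
  apply: ler_pM; rewrite ?sqr_ge0 ?invr_ge0 ?mulr_ge0 ?sqr_ge0 ?(ltW a0) ?(ltW c0)//.
    by rewrite ler_sqr ?nnegrE ?subr_ge0// divr_ge0 ?subr_ge0// mulr_ge0// ltW.
  rewrite lef_pV2 ?posrE ?mulr_gt0 ?exprn_gt0//.
  apply: ler_pM; rewrite ?mulr_ge0 ?sqr_ge0 ?(ltW m0)//.
    by rewrite ler_pM2l// (le_trans mc).
  by rewrite ler_sqr ?nnegrE ?(ltW m0) ?(ltW c0).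
rewrite normrM (ger0_norm (divr_ge0 (sqr_ge0 _) _)); last first.
  by rewrite !mulr_ge0 ?sqr_ge0 ?(ltW a0) ?(ltW c0).
have xM : `|x t| <= M by apply: HM; rewrite (le_trans s0 st).
apply: (le_trans (ler_pM (normr_ge0 _) _ xM ac)).
  by rewrite divr_ge0 ?sqr_ge0// !mulr_ge0 ?sqr_ge0 ?(ltW a0) ?(ltW c0).
have -> : M * ((t - s) ^+ 2 / (8 * m ^+ 5)) = (q * (t - s)) * (t - s).
  by rewrite /q; field; rewrite gt_eqF.
rewrite ler_wpM2r ?subr_ge0//; move: stq; rewrite ltr_pdivlMr// => /ltW.
by rewrite mulrC.
Qed.

End sde_riemann_sums.

(** * Riemann sums in logarithmic time *)

Section log_time.
Context {R : realType}.
Implicit Types (x b : R -> R) (T : R).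

Definition log_time T (u : R) : R := T - expR (- u).

Definition log_bridge T x (u : R) : R := x (log_time T u) / Num.sqrt (T - log_time T u).

Lemma log_time_lt T u : log_time T u < T.
Proof. by rewrite /log_time ltrBlDr ltrDl expR_gt0. Qed.

Lemma log_time_ge0 T u : 0 < T -> - ln T <= u -> 0 <= log_time T u.
Proof.
by move=> T0 Tu; rewrite /log_time subr_ge0 -[leRHS](lnK T0)// ler_expR lerNl.
Qed.

Lemma log_time_le T u v : u <= v -> log_time T u <= log_time T v.
Proof. by move=> uv; rewrite lerD2l lerN2 ler_expR lerN2. Qed.

Lemma log_timeB T u h : log_time T (u + h) - log_time T u = expR (- u) * (1 - expR (- h)).
Proof. by rewrite /log_time opprD expRD; ring. Qed.

(** In a cell of length h in logarithmic time, B increases by a variance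
    exp (- u) (1 - exp (- h)), and dividing by sqrt (T - t) = exp (- u / 2) leaves
    1 - exp (- h); this factor brings the variance to h. *)
Definition cell_scale (h : R) : R := Num.sqrt (h / (1 - expR (- h))).

Lemma cell_scale_ge1 h : 0 < h -> 1 <= cell_scale h.
Proof.
move=> h0; rewrite -[leLHS]sqrtr1 ler_wsqrtr// ler_pdivlMr ?mul1r.
  by rewrite lerBlDr addrC -lerBlDr; exact: expR_ge1Dx.
by rewrite subr_gt0 -[ltRHS]expR0 ltr_expR oppr_lt0.
Qed.

Lemma cell_scale_le h : 0 < h -> cell_scale h <= expR (h / 2).
Proof.
move=> h0; rewrite -[leRHS]ger0_norm ?expR_ge0// -sqrtr_sqr ler_wsqrtr//.
rewrite expr2 -expRD -splitr ler_pdivrMr; last first.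
  by rewrite subr_gt0 -[ltRHS]expR0 ltr_expR oppr_lt0.
by rewrite mulrBr mulr1 -expRD subrr expR0 lerBrDr addrC; exact: expR_ge1Dx.
Qed.

Definition log_cell T (u v : R) (N i : nat) : R := u + i%:R * ((v - u) / N.+1%:R).

Lemma log_cellS T u v N i : log_cell T u v N i.+1 = log_cell T u v N i + (v - u) / N.+1%:R.
Proof. by rewrite /log_cell -natr1 mulrDl mul1r addrA. Qed.

Definition log_weight T (u v : R) (N i : nat) : R :=
  cell_scale ((v - u) / N.+1%:R) / Num.sqrt (T - log_time T (log_cell T u v N i)).

Definition log_sum T b (u v : R) (N : nat) : R :=
  \sum_(0 <= i < N.+1) log_weight T u v N i *
    (b (log_time T (log_cell T u v N i.+1)) - b (log_time T (log_cell T u v N i))).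

(** The errors of bridge_path_cell add up to at most e, because the lengths of the
    cells add up to at most T; and cell_scale tends to 1 as the cells shrink. *)
Lemma log_sum_cvg T x b u v : 0 < T -> - ln T <= u -> u < v ->
  {within `[0, T[, continuous x} -> bridge_path T x b ->
  log_sum T b u v N @[N --> \oo] --> log_bridge T x v - log_bridge T x u.
Proof.
move=> T0 Tu uv cx Hx.
pose h (N : nat) := (v - u) / N.+1%:R.
have h0 N : 0 < h N by rewrite divr_gt0 ?subr_gt0.
have hcvg : h N @[N --> \oo] --> (0:R).
  rewrite -(mulr0 (v - u)); apply: cvgM; first exact: cvg_cst.
  exact: cvg_harmonic.
have kcvg : cell_scale (h N) @[N --> \oo] --> (1:R).
  apply: (@squeeze_cvgr _ _ _ _ (fun=> 1) (fun N => expR (h N / 2))).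
  - by near=> N; rewrite cell_scale_ge1// cell_scale_le.
  - exact: cvg_cst.
  - suff : expR (h N / 2) @[N --> \oo] --> (expR 0 : R) by rewrite expR0.
    apply: continuous_cvg; first exact: continuous_expR.
    by rewrite -(mul0r (2^-1:R)); apply: cvgM => //; exact: cvg_cst.
pose s N i := log_time T (log_cell T u v N i).
pose S0 N := \sum_(0 <= i < N.+1) (b (s N i.+1) - b (s N i)) / Num.sqrt (T - s N i).
have -> : log_sum T b u v = fun N => cell_scale (h N) * S0 N.
  by apply/funext => N; rewrite mulr_sumr; apply: eq_bigr => i _; rewrite mulrCA mulrC.
rewrite -[X in _ --> X]mul1r; apply: cvgM => //.
have cell0 N : log_cell T u v N 0 = u by rewrite /log_cell mul0r addr0.
have cellN N : log_cell T u v N N.+1 = v.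
  by rewrite /log_cell mulrC divfK ?pnatr_eq0// addrC subrK.
have cell_ge N i : u <= log_cell T u v N i.
  by rewrite /log_cell lerDl mulr_ge0// ltW//; exact: h0.
apply/cvgrPdist_le => e e0.
have V0 : 0 <= log_time T v < T.
  by rewrite log_time_lt andbT log_time_ge0// (le_trans Tu)// ltW.
have [r r0 Hr] := bridge_path_cell V0 cx Hx (divr_gt0 e0 T0).
near=> N.
have hr : T * h N < r.
  rewrite mulrC -ltr_pdivlMr//; near: N.
  move/cvgrPdist_lt : hcvg => /(_ _ (divr_gt0 r0 T0)); apply: filterS => N.
  by rewrite sub0r normrN gtr0_norm.
have -> : log_bridge T x v - log_bridge T x u =
   \sum_(0 <= i < N.+1) (x (s N i.+1) / Num.sqrt (T - s N i.+1) - x (s N i) / Num.sqrt (T - s N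
     i)).
  by rewrite (telescope_sumr (fun i => x (s N i) / Num.sqrt (T - s N i)))// /s cell0 cellN.
rewrite -sumrB (le_trans (ler_norm_sum _ _ _))//.
apply: (@le_trans _ _ (\sum_(0 <= i < N.+1) e / T * (s N i.+1 - s N i))).
  rewrite big_nat [leRHS]big_nat; apply: ler_sum => i /andP[_ iN].
  apply: Hr.
  - by apply: log_time_ge0 => //; rewrite (le_trans Tu).
  - by apply: log_time_le; rewrite log_cellS lerDl ltW//; exact: h0.
  - apply: log_time_le; rewrite -[leRHS](cellN N) /log_cell lerD2l ler_wpM2r ?ler_nat//.
    by rewrite ltW//; exact: h0.
  - apply: le_lt_trans hr; rewrite /s log_cellS log_timeB; apply: ler_pM.
    + exact: expR_ge0.
    + by rewrite subr_ge0 -[leRHS]expR0 ler_expR oppr_le0 ltW//; exact: h0.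
    + by rewrite -[leRHS](lnK T0)// ler_expR lerNl (le_trans Tu).
    + by rewrite lerBlDr addrC -lerBlDr; exact: expR_ge1Dx.
rewrite -mulr_sumr telescope_sumr// mulrAC -mulrA ler_piMr ?(ltW e0)//.
rewrite ler_pdivrMr// mul1r /s cellN lerBlDr (le_trans (ltW (log_time_lt T v)))// lerDl.
by rewrite cell0 log_time_ge0.
Unshelve. all: by end_near. Qed.

(** Each term of log_sum has variance exactly the length of its cell in logarithmic
    time. *)
Lemma log_weight_std T u v N i : u < v ->
  log_weight T u v N i * Num.sqrt (log_time T (log_cell T u v N i.+1) - log_time T (log_cell T
    u v N i))
  = Num.sqrt ((v - u) / N.+1%:R).
Proof.
move=> uv; have h0 : 0 < (v - u) / N.+1%:R by rewrite divr_gt0 ?subr_gt0.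
rewrite log_cellS log_timeB /log_weight /log_time subKr sqrtrM ?expR_ge0//.
have e0 : 0 < Num.sqrt (expR (- log_cell T u v N i)) by rewrite sqrtr_gt0 expR_gt0.
rewrite mulrA divfK ?gt_eqF// /cell_scale -sqrtrM; last first.
  by rewrite divr_ge0 ?(ltW h0)// subr_ge0 -[leRHS]expR0 ler_expR oppr_le0 ltW.
by rewrite divfK// gt_eqF// subr_gt0 -[ltRHS]expR0 ltr_expR oppr_lt0.
Qed.

End log_time.

(** * The law of the bridge in logarithmic time *)

Section probability_limits.
Context d (Omega : measurableType d) (R : realType) (P : probability Omega R).

Lemma ae_probability_le (A C : set Omega) : measurable A -> measurable C ->
  {ae P, forall w, A w -> C w} -> (P A <= P C)%E.
Proof.
move=> mA mC [Z [mZ PZ0 HZ]].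
apply: (@le_trans _ _ (P (C `|` Z))).
  apply: le_measure; rewrite ?inE//; first exact: measurableU.
  move=> w Aw; have [Cw|nC] := pselect (C w); first by left.
  by right; apply: HZ => /= H; exact/nC/H.
apply: le_trans (measureU2 _ mC mZ) _.
by rewrite -[leRHS]adde0; apply: leeD => //; rewrite le_eqVlt; apply/orP; left; apply/eqP;
  exact: PZ0.
Qed.

Lemma probability_ae1 (A : set Omega) : measurable A -> {ae P, forall w, A w} -> P A = 1%E.
Proof.
move=> mA aeA; apply/eqP; rewrite eq_le probability_le1//= -(probability_setT P).
by apply: ae_probability_le => //; apply: filterS aeA => w Aw _.
Qed.

(** Fatou's lemma for indicator functions: the inner intersections increase with m. *)
Lemma liminf_set_prob_le (D : nat -> set Omega) (c : \bar R) :
  (forall n, measurable (D n)) -> (forall n, P (D n) <= c)%E ->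
  (P (\bigcup_m \bigcap_(n in [set n | (m <= n)%N]) D n) <= c)%E.
Proof.
move=> mD Dc.
have mI m : measurable (\bigcap_(n in [set n | (m <= n)%N]) D n).
  by apply: bigcap_measurable => //; exists m => /=.
have nd : nondecreasing_seq (fun m => \bigcap_(n in [set n | (m <= n)%N]) D n).
  by move=> m p mp; apply/subsetPset => w H i /= pi; apply: H => /=; exact: leq_trans pi.
have cv := nondecreasing_cvg_mu (mu := P) mI (bigcup_measurable (fun k _ => mI k)) nd.
rewrite -(cvg_lim _ cv)//; apply: lime_le; first exact: cvgP cv.
apply: nearW => m; apply: le_trans (Dc m).
by apply: le_measure; rewrite ?inE//; move=> w; apply => /=.
Qed.

End probability_limits.

Section log_bridge_process.
Context d (Omega : measurableType d) (R : realType) (P : probability Omega R).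

(** A Brownian motion satisfies this with an equality, for all measurable sets.  The
    inequality on open sets is what survives an almost sure limit without any
    study of the boundaries of the sets. *)
Definition brownian_on_open (W : R -> Omega -> R) (u0 : R) : Prop :=
  forall (n : nat) (t : nat -> R) (O : nat -> set R),
    u0 <= t 0%N -> (forall i, t i < t i.+1) -> (forall i, open (O i)) ->
    (P (\bigcap_(k in [set k | (0 <= k < n)%N]) [set w | O k (W (t k.+1) w - W (t k) w)%R]) <=
     \prod_(0 <= k < n) normal_prob 0 (Num.sqrt (t k.+1 - t k)%R) (O k))%E.

Variables (T : R) (B X : R -> {RV P >-> R}).
Hypotheses (T0 : 0 < T) (hB : standard_wiener_process B).

Section blocks.
Variables (t : nat -> R) (N : nat).
Hypotheses (Tt : - ln T <= t 0%N) (tS : forall i, t i < t i.+1).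

(* The cell number i is the cell j i of the block k i, which is the interval from
    t (k i) to t (k i).+1 cut into N.+1 cells of equal lengths. *)
Let k i := (i %/ N.+1)%N.
Let j i := (i %% N.+1)%N.
Let tau i := log_time T (log_cell T (t (k i)) (t (k i).+1) N (j i)).
Let weight i := log_weight T (t (k i)) (t (k i).+1) N (j i).
Let f i : (Omega -> R) * R :=
  (fun w => weight i * (B (tau i.+1) w - B (tau i) w),
   Num.sqrt ((t (k i).+1 - t (k i)) / N.+1%:R)).

Let tauS i : tau i.+1 = log_time T (log_cell T (t (k i)) (t (k i).+1) N (j i).+1).
Proof.
rewrite /tau /k /j; congr log_time.
have := ltn_pmod i (ltn0Sn N); rewrite leq_eqVlt => /orP[/eqP E|lt].
  have iE : (i.+1 = (i %/ N.+1).+1 * N.+1)%N by rewrite [in LHS](divn_eq i N.+1) mulSn -addnS E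
    addnC.
  rewrite E iE mulnK// modnMl /log_cell mul0r addr0 mulrC divfK ?pnatr_eq0//.
  by rewrite addrC subrK.
have iE : (i.+1 = i %/ N.+1 * N.+1 + (i %% N.+1).+1)%N by rewrite addnS -divn_eq.
have -> : (i.+1 %/ N.+1 = i %/ N.+1)%N by rewrite [in LHS]iE divnMDl// (divn_small lt) addn0.
by have -> : (i.+1 %% N.+1 = (i %% N.+1).+1)%N by rewrite [in LHS]iE modnMDl modn_small.
Qed.

Let t_ge i : - ln T <= t i.
Proof. by elim: i => [//|i IH]; rewrite (le_trans IH)// ltW. Qed.

Let tau_ge0 i : 0 <= tau i.
Proof.
apply: log_time_ge0 => //; rewrite (le_trans (t_ge (k i)))// lerDl mulr_ge0//.
by rewrite divr_ge0// subr_ge0 ltW.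
Qed.

Let tau_lt i : tau i < tau i.+1.
Proof.
rewrite tauS /tau log_cellS -subr_gt0 log_timeB mulr_gt0 ?expR_gt0// subr_gt0.
by rewrite -[ltRHS]expR0 ltr_expR oppr_lt0 divr_gt0 ?subr_gt0.
Qed.

Let weight_gt0 i : 0 < weight i.
Proof.
rewrite /weight /log_weight; apply: divr_gt0; last first.
  by rewrite sqrtr_gt0 subr_gt0 log_time_lt.
by apply: (lt_le_trans ltr01); rewrite cell_scale_ge1// divr_gt0 ?subr_gt0.
Qed.

Let gauss_law_cells m : gauss_law P [seq f i | i <- iota 0 m] setT 1%E.
Proof.
have mf i : measurable_fun setT (f i).1 /\ 0 < (f i).2.
  split; last by rewrite sqrtr_gt0 divr_gt0 ?subr_gt0.
  by apply: measurable_funM => //; apply: measurable_funB.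
apply/gauss_law_mkseqP => // A mA.
have [_ ind law _] := hB.
pose A' i := (fun x => weight i * x + 0) @^-1` A i.
have mA' i : measurable (A' i).
  rewrite /A' -[X in measurable X]setTI.
  have /(_ measurableT _ (mA i)) : measurable_fun setT (fun x : R => weight i * x + 0).
    by apply: measurable_funD => //; exact: measurable_funM.
  exact.
have := ind m tau A' (tau_ge0 0%N) _ mA'.
rewrite setTI mul1e big_mkord add0n.
rewrite (_ : \bigcap_(i in [set i | (0 <= i < m)%N]) (f i).1 @^-1` A i =
  \bigcap_(i < m) (B (tau i.+1) \- B (tau i)) @^-1` A' i); last first.
  by apply: eq_bigcapr => i _; rewrite /A'; apply/seteqP; split => w /=; rewrite addr0.
move=> ->; last by apply: homo_leq => [//|y x z|i]; [exact: le_trans|exact/ltW].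
apply: eq_bigr => i _.
have s0 : 0 < Num.sqrt (tau i.+1 - tau i) by rewrite sqrtr_gt0 subr_gt0.
have := law (tau i) (tau i.+1) (A' i) (tau_ge0 i) (tau_lt i) (mA' i).
rewrite /pushforward => ->.
rewrite (normal_prob_affine 0 (weight_gt0 i) s0 (mA i)).
by rewrite [in LHS]tauS [X in normal_prob _ X _](log_weight_std _ _ _ (tS (k i))).
Qed.

Lemma gauss_law_log_sum n :
  gauss_law P [seq (fun w => log_sum T (fun s => B s w) (t k) (t k.+1) N,
                    Num.sqrt (t k.+1 - t k)) | k <- iota 0 n] setT 1%E.
Proof.
have := gauss_law_cells (n * N.+1).
rewrite -flatten_iota => /(gauss_law_blocks
  (Y := fun k => f (k * N.+1 + 0)%N) (l := fun k => [seq f (k * N.+1 + i)%N | i <- iota 1 N])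
    measurableT).
rewrite [X in gauss_law _ X](@eq_map _ _ _ (fun k => (fun w => log_sum T (fun s => B s w) (t k)
  (t k.+1) N,
                    Num.sqrt (t k.+1 - t k))))// => q.
have kE i : (i < N.+1)%N -> k (q * N.+1 + i) = q.
  by move=> iN; rewrite /k divnMDl// divn_small// addn0.
have jE i : (i < N.+1)%N -> j (q * N.+1 + i) = i.
  by move=> iN; rewrite /j modnMDl modn_small.
rewrite foldl_gauss_add ?sqrtr_ge0//; congr pair.
  apply/funext => w; rewrite big_map /log_sum big_ltn//; congr (_ + _).
    by rewrite /= tauS /tau /weight kE// jE.
  rewrite /index_iota subSS subn0 big_seq [RHS]big_seq; apply: eq_bigr => i.
  rewrite mem_iota add1n => /andP[_ iN].
  by rewrite /= tauS /tau /weight kE// jE.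
have h0 : 0 <= (t q.+1 - t q) / N.+1%:R by rewrite divr_ge0 ?subr_ge0 ?ltW.
have fE i : (i < N.+1)%N -> (f (q * N.+1 + i)).2 ^+ 2 = (t q.+1 - t q) / N.+1%:R.
  by move=> iN; rewrite /= kE// sqr_sqrtr.
rewrite fE// big_map (_ : iota 1 N = index_iota 1 N.+1); last by rewrite /index_iota subSS subn0.
rewrite big_nat.
rewrite (eq_bigr (fun=> (t q.+1 - t q) / N.+1%:R)); last by move=> i /andP[_]; exact: fE.
rewrite -big_nat sumr_const_nat subSS subn0 -mulrS.
by rewrite -[X in Num.sqrt X]mulr_natr divfK// pnatr_eq0.
Qed.

End blocks.

Hypothesis hX : bridge_strong_solution 2^-1 T B X.

Definition log_bridge_process (u : R) (w : Omega) : R := log_bridge T (fun s => X s w) u.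

Lemma measurable_log_bridge_process u : measurable_fun setT (log_bridge_process u).
Proof. by apply: measurable_funM. Qed.

Lemma continuous_log_bridge_process w :
  {within `[- ln T, +oo[, continuous (log_bridge_process ^~ w)}.
Proof.
have [_ /(_ w)/subspace_continuousP cX _ _] := hX.
apply/subspace_continuousP => u; rewrite /= in_itv/= andbT => Tu.
have cl : {for u, continuous (log_time T)}.
  apply: cvgB; first exact: cvg_cst.
  apply: continuous_cvg; first exact: continuous_expR.
  by apply: cvgN; exact: cvg_id.
apply: cvgM; last first.
  apply: cvg_within_filter; apply: cvgV.
    by rewrite gt_eqF// sqrtr_gt0 subr_gt0 log_time_lt.
  apply: continuous_cvg; first exact: sqrt_continuous.
  by apply: cvgB; [exact: cvg_cst|exact: cl].
have uT : `[0, T[%classic (log_time T u) by rewrite /= in_itv/= log_time_ge0 ?log_time_lt.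
apply: (@cvg_comp _ _ _ (log_time T) (fun s => X s w) _
  (within `[0, T[ (nbhs (log_time T u)))); last exact: cX.
move=> S HS.
have HS' : nbhs u (fun v => `[0, T[%classic (log_time T v) -> S (log_time T v)) by exact: cl _ HS.
suff : nbhs u (fun v => `[- ln T, +oo[%classic v -> S (log_time T v)) by [].
apply: filterS HS' => v /= HSv vT; apply: HSv.
by move: vT; rewrite /= !in_itv/= andbT => vT; rewrite log_time_ge0 ?log_time_lt.
Qed.

(** If the increments of W lie in the open sets, so do the Riemann sums, eventually
    and almost surely; the Riemann sums satisfy the product formula exactly. *)
Lemma log_bridge_on_open : brownian_on_open log_bridge_process (- ln T).
Proof.
move=> n t O Tt tS oO.
have [_ cX _ eqX] := hX.
pose D N := \bigcap_(k in [set k | (0 <= k < n)%N])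
  (fun w => log_sum T (fun s => B s w) (t k) (t k.+1) N) @^-1` O k.
have mO k : measurable (O k) by exact: open_measurable.
have mls k N : measurable_fun setT (fun w => log_sum T (fun s => B s w) (t k) (t k.+1) N).
  apply: measurable_sum => i.
  by apply: measurable_funM => //; apply: measurable_funB.
have mD N : measurable (D N).
  by apply: bigcap_measurableType => k _; rewrite -[X in measurable X]setTI; exact: mls.
have PD N : (P (D N) <= \prod_(0 <= k < n) normal_prob 0 (Num.sqrt (t k.+1 - t k)%R) (O k))%E.
  have := @gauss_law_log_sum t N Tt tS n.
  move=> /gauss_law_mkseqP H; rewrite le_eqVlt; apply/orP; left; apply/eqP.
  have := H _ O mO; rewrite setTI mul1e add0n => <- //.
  by move=> k; rewrite sqrtr_gt0 subr_gt0; split => //; exact: mls.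
apply: le_trans (liminf_set_prob_le mD PD).
apply: ae_probability_le.
- apply: bigcap_measurableType => k _.
  rewrite -[X in measurable X]setTI;
    apply: (measurable_funB (f := log_bridge_process (t k.+1))) => //;
   exact: measurable_log_bridge_process.
- by apply: bigcup_measurable => m _; apply: bigcap_measurableType.
have t_ge i : - ln T <= t i by elim: i => [//|i IH]; rewrite (le_trans IH)// ltW.
apply: filterS eqX => w eqXw Hw.
have near_O k : (k < n)%N ->
    \forall N \near \oo, O k (log_sum T (fun s => B s w) (t k) (t k.+1) N).
  move=> kn; apply: (log_sum_cvg T0 (t_ge k) (tS k) (cX w) eqXw).
  by apply: open_nbhs_nbhs; split => //; exact: Hw.
have : \forall N \near \oo, forall k : 'I_n, O k (log_sum T (fun s => B s w) (t k) (t k.+1) N).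
  by apply: filter_forall => k; exact: near_O.
move=> [m _ Hm]; exists m => // N /= mN k /= kn.
exact: (Hm _ mN (Ordinal kn)).
Qed.

End log_bridge_process.

(** * Iterated logarithms *)

Section iterated_logarithms.
Context {R : realType}.

Definition lil_norm (u : R) : R := Num.sqrt (2 * u * ln (ln u)).

Lemma ln_ge1 (u : R) : expR 1 <= u -> 1 <= ln u.
Proof. by move=> eu; rewrite -[leLHS]expRK ler_ln ?posrE ?(lt_le_trans _ eu) ?expR_gt0. Qed.

Lemma lnln_ge0 (u : R) : expR 1 <= u -> 0 <= ln (ln u).
Proof. by move=> eu; rewrite ln_ge0// ln_ge1. Qed.

Lemma lnln_le (u v : R) : expR 1 <= u -> u <= v -> ln (ln u) <= ln (ln v).
Proof.
move=> eu uv; have u1 := ln_ge1 eu; have v1 := ln_ge1 (le_trans eu uv).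
rewrite ler_ln ?posrE ?(lt_le_trans ltr01)// ler_ln ?posrE//.
  by rewrite (lt_le_trans _ eu) ?expR_gt0.
by rewrite (lt_le_trans _ (le_trans eu uv)) ?expR_gt0.
Qed.

Lemma lil_norm_sqr (u : R) : expR 1 <= u -> lil_norm u ^+ 2 = 2 * u * ln (ln u).
Proof.
move=> eu; rewrite sqr_sqrtr// !mulr_ge0 ?lnln_ge0//.
by rewrite (le_trans _ eu) ?expR_ge0.
Qed.

Lemma lil_norm_scale (k u v : R) : 0 <= k -> expR 1 <= u -> u <= v -> u <= k * v ->
  lil_norm u <= Num.sqrt k * lil_norm v.
Proof.
move=> k0 eu uv ukv; rewrite -sqrtrM// ler_wsqrtr//.
have u0 : 0 <= u by rewrite (le_trans _ eu) ?expR_ge0.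
rewrite mulrA [k * (2 * v)]mulrCA; apply: ler_pM; rewrite ?mulr_ge0 ?lnln_ge0//.
  by rewrite ler_pM2l.
exact: lnln_le.
Qed.

Lemma lil_norm_le (u v : R) : expR 1 <= u -> u <= v -> lil_norm u <= lil_norm v.
Proof.
by move=> eu uv; rewrite -[leRHS]mul1r -[X in X * _]sqrtr1 lil_norm_scale// mul1r.
Qed.

Lemma lil_norm_ge (K u : R) : 0 <= K -> expR (expR 1) <= u -> K ^+ 2 <= u -> K <= lil_norm u.
Proof.
move=> K0 eu Ku.
have u0 : 0 <= u by rewrite (le_trans _ eu) ?expR_ge0.
have l1 : 1 <= ln (ln u).
  rewrite ln_ge1// -[leLHS]expRK ler_ln ?posrE ?expR_gt0//.
  by rewrite (lt_le_trans _ eu) ?expR_gt0.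
rewrite -[leLHS]ger0_norm// -sqrtr_sqr ler_wsqrtr// (le_trans Ku)//.
rewrite -mulrA [2 * _]mulrC -mulrA ler_peMr// mulr_ege1// ler1n//.
Qed.

Definition lil_time (s : R) (n : nat) : R := expR (s * n%:R).

(** Makes the series of n^(- 1 - e) telescope: with d = ln (n + 1) - ln n, one has
    d >= 1 / (n + 1) and exp (e d) >= 1 + e d. *)
Lemma telescope_expR_ln (e : R) (n : nat) : 0 < e -> (0 < n)%N ->
  e * expR (- ((1 + e) * ln n.+1%:R)) <= expR (- (e * ln n%:R)) - expR (- (e * ln n.+1%:R)).
Proof.
move=> e0 n0.
have n0' : 0 < n%:R :> R by rewrite ltr0n.
have l : n.+1%:R^-1 <= ln n.+1%:R - ln n%:R :> R.
  have : ln (1 + - n.+1%:R^-1) <= - n.+1%:R^-1 :> R.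
    by apply: le_ln1Dx; rewrite ltrN2 invf_lt1// ltr1n.
  have -> : 1 + - n.+1%:R^-1 = n%:R / n.+1%:R :> R by rewrite -natr1; field;
    rewrite natr1 pnatr_eq0.
  by rewrite ln_div ?posrE// lerNr opprB.
have -> : expR (- (e * ln n%:R)) = expR (- (e * ln n.+1%:R)) * expR (e * (ln n.+1%:R - ln n%:R)).
  by rewrite -expRD; congr expR; ring.
have -> : expR (- ((1 + e) * ln n.+1%:R)) = expR (- (e * ln n.+1%:R)) * n.+1%:R^-1.
  by rewrite mulrDl mul1r opprD expRD mulrC [in X in _ * X = _]expRN lnK ?posrE.
rewrite -[X in _ <= _ - X]mulr1 -mulrBr mulrCA ler_pM2l ?expR_gt0// lerBrDl.
by apply: le_trans (expR_ge1Dx _); rewrite lerD2l ler_pM2l.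
Qed.

Lemma ln_succ_le (n : nat) : ln n.+2%:R - ln n.+1%:R <= n.+1%:R^-1 :> R.
Proof.
rewrite -ln_div ?posrE ?ltr0n//.
have -> : n.+2%:R / n.+1%:R = 1 + n.+1%:R^-1 :> R.
  by rewrite -[n.+2%:R]natr1 mulrDl mul1r divff// pnatr_eq0.
by apply: le_ln1Dx; rewrite (lt_trans (ltrN10 R))// invr_gt0 ltr0n.
Qed.

(** 1 - x <= exp (- x), and the sum of 1 / n dominates the telescoping sum of
    ln (n + 1) - ln n. *)
Lemma prod_harmonic_le (p : nat -> \bar R) (c : R) (n0 m : nat) : 0 <= c ->
  (forall k, 0 <= p k)%E ->
  (forall k, p k <= (1 - c / (n0 + k).+1%:R)%:E)%E ->
  (\prod_(0 <= k < m) p k <= (expR (- (c * (ln (n0 + m).+1%:R - ln n0.+1%:R))))%:E)%E.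
Proof.
move=> c0 p0 pc; elim: m => [|m IH].
  by rewrite big_geq// addn0 subrr mulr0 oppr0 expR0.
rewrite big_nat_recr//=; have -> : expR (- (c * (ln (n0 + m.+1).+1%:R - ln n0.+1%:R))) =
    expR (- (c * (ln (n0 + m).+1%:R - ln n0.+1%:R))) *
    expR (- (c * (ln (n0 + m).+2%:R - ln (n0 + m).+1%:R))).
  by rewrite -expRD addnS; congr expR; ring.
rewrite EFinM; apply: lee_pmul => //.
  by elim/big_ind: _ => // *; exact: mule_ge0.
apply: le_trans (pc m) _; rewrite lee_fin.
apply: le_trans (expR_ge1Dx _); rewrite lerD2l lerN2 ler_wpM2l//.
exact: ln_succ_le.
Qed.

End iterated_logarithms.

(** * Dyadic chaining *)

Section dyadic_chaining.
Context {R : realType}.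

Lemma bernoulli_nine_eighths (m : nat) : 1 + m%:R / 8 <= (9 / 8 : R) ^+ m.
Proof.
elim: m => [|m IH]; first by rewrite mul0r addr0.
rewrite exprS (le_trans _ (ler_wpM2l _ IH))// -natr1.
have : 0 <= m%:R :> R by [].
move: (m%:R : R) => y y0; lra.
Qed.

(** A dyadic point of level m + 1 is either a dyadic point of level m, or the right
    neighbour of one at distance L / 2^(m + 1). *)
Lemma dyadic_sum_le (f : R -> R) (a L : R) (x : nat -> R) (m : nat) :
  (forall i, 0 <= x i) ->
  (forall i j, (i <= m)%N -> (j < 2 ^ i)%N ->
    `|f (a + j.+1%:R * (L / (2 ^ i)%:R)) - f (a + j%:R * (L / (2 ^ i)%:R))| <= x i) ->
  forall j, (j <= 2 ^ m)%N ->
   `|f (a + j%:R * (L / (2 ^ m)%:R)) - f a| <= \sum_(0 <= i < m.+1) x i.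
Proof.
move=> x0; elim: m => [|m IH] fx j.
  rewrite big_nat1 leq_eqVlt => /orP[/eqP ->|]; last first.
    by rewrite ltnS leqn0 => /eqP ->; rewrite mul0r addr0 subrr normr0.
  by have := fx 0%N 0%N isT isT; rewrite mul0r addr0.
move=> jm.
have half i : a + (i.*2)%:R * (L / (2 ^ m.+1)%:R) = a + i%:R * (L / (2 ^ m)%:R).
  congr (a + _); rewrite expnS natrM -muln2 natrM.
  by field; rewrite pnatr_eq0 expn_eq0.
have {}IH i : (i <= 2 ^ m)%N ->
  `|f (a + i%:R * (L / (2 ^ m)%:R)) - f a| <= \sum_(0 <= i < m.+1) x i.
  by apply: IH => i' j' i'm; apply: fx; rewrite (leq_trans i'm).
rewrite big_nat_recr//= -[j](odd_double_half j); case: (boolP (odd j)) => oj; last first.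
  rewrite add0n half (le_trans (IH _ _)) ?lerDl//.
  by rewrite -leq_double -[(2 ^ m).*2]mul2n -expnS (leq_trans _ jm)// -[leqRHS]odd_double_half
    leq_addl.
have jE : (1 + j./2.*2 = j)%N by rewrite -[RHS]odd_double_half oj.
have jl : (j./2.*2 < 2 ^ m.+1)%N by rewrite (leq_trans _ jm)// -[leqRHS]jE.
apply: le_trans (ler_distD (f (a + (j./2.*2)%:R * (L / (2 ^ m.+1)%:R))) _ _) _.
rewrite [leRHS]addrC lerD//; first exact: fx.
by rewrite half; apply: IH; move: jl; rewrite expnS mul2n ltn_double => /ltnW.
Qed.

(** The geometric ratio 3/4 exceeds 1 / sqrt 2, the ratio of the standard deviations
    of Brownian increments over successive dyadic scales; the sum of its powers
    is 4. *)
Lemma dyadic_chaining (f : R -> R) (a L c : R) : 0 < L -> 0 <= c ->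
  {within `[a, a + L], continuous f} ->
  (forall m j, (j < 2 ^ m)%N ->
    `|f (a + j.+1%:R * (L / (2 ^ m)%:R)) - f (a + j%:R * (L / (2 ^ m)%:R))| <= c * (3 / 4) ^+
      m) ->
  forall u, a <= u <= a + L -> `|f u - f a| <= 4 * c.
Proof.
move=> L0 c0 cf fx u /andP[au uL].
have sum4 m : \sum_(0 <= i < m.+1) c * (3 / 4) ^+ i <= 4 * c.
  rewrite -mulr_sumr [leRHS]mulrC ler_wpM2l//.
  have -> : \sum_(0 <= i < m.+1) (3 / 4 : R) ^+ i = 4 - 4 * (3 / 4) ^+ m.+1.
    elim: m => [|m IH]; first by rewrite big_nat1; field.
    by rewrite big_nat_recr//= IH [in RHS]exprS; field.
  by rewrite gerBl mulr_ge0// exprn_ge0// divr_ge0.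
apply/ler_addgt0Pr => e e0.
have uI : `[a, a + L]%classic u by rewrite /= in_itv/= au.
have [r r0 Hr] := within_continuous_dist cf uI e0.
have [m Hm] : exists m, L / (2 ^ m)%:R < r.
  exists (Num.truncn (L / r)); rewrite ltr_pdivrMr ?ltr0n ?expn_gt0//.
  by rewrite mulrC -ltr_pdivrMr// (lt_le_trans (truncnS_gt _))// ler_nat ltn_expl.
set i := Num.truncn ((u - a) / (L / (2 ^ m)%:R)).
have l0 : 0 < L / (2 ^ m)%:R by rewrite divr_gt0// ltr0n expn_gt0.
have [ui iu] : i%:R * (L / (2 ^ m)%:R) <= u - a /\ u - a < i.+1%:R * (L / (2 ^ m)%:R).
  rewrite -ler_pdivlMr// -ltr_pdivrMr//; split; last exact: truncnS_gt.
  by rewrite truncn_le// divr_ge0 ?subr_ge0// ltW.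
have im : (i <= 2 ^ m)%N.
  rewrite -(ler_nat R) -(ler_pM2r l0) (le_trans ui)// mulrC divfK ?pnatr_eq0 ?expn_eq0//.
  by rewrite lerBlDl.
set v := a + i%:R * (L / (2 ^ m)%:R).
have fv : `|f v - f a| <= 4 * c.
  apply: le_trans (sum4 m); apply: dyadic_sum_le => // k.
    by rewrite mulr_ge0// exprn_ge0// divr_ge0.
  by move=> j _; exact: fx.
apply: le_trans (ler_distD (f v) _ _) _; rewrite [leRHS]addrC; apply: lerD => //; apply/ltW/Hr.
  rewrite /= in_itv/= /v lerDl mulr_ge0 ?(ltW l0)//=.
  by rewrite (le_trans _ uL)// -lerBrDl.
rewrite (le_lt_trans _ Hm)// /v opprD addrA ger0_norm ?subr_ge0// lerBlDr.
by move: iu; rewrite -natr1 mulrDl mul1r [ltRHS]addrC => /ltW.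
Qed.

End dyadic_chaining.

(** * Probability bounds for the increments *)

Section borel_cantelli_bounds.
Context d (Omega : measurableType d) (R : realType) (P : probability Omega R).

(** The Borel-Cantelli lemma; the telescoping bound makes the series of the
    probabilities converge. *)
Lemma ae_eventually_not (E : nat -> set Omega) (a : nat -> R) :
  (forall n, measurable (E n)) -> (forall n, 0 <= a n) ->
  (forall n, P (E n) <= (a n - a n.+1)%:E)%E ->
  {ae P, forall w, exists m, forall n, (m <= n)%N -> ~ E n w}.
Proof.
move=> mE a0 PE.
have : P (lim_sup_set E) = 0%E.
  apply: lim_sup_set_cvg0 => //.
  apply: (@le_lt_trans _ _ (a 0%N)%:E); last exact: ltry.
  apply: lime_le; first exact: is_cvg_nneseries.
  apply: nearW => n; apply: (@le_trans _ _ (\sum_(0 <= i < n) (a i - a i.+1)%:E)%E).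
    by apply: lee_sum => i _; exact: PE.
  rewrite sumEFin lee_fin (eq_bigr (fun i => - (a i.+1 - a i))); last by move=> i _;
    rewrite opprB.
  by rewrite sumrN telescope_sumr// opprB gerBl.
move=> P0; exists (lim_sup_set E); split => //.
  by apply: bigcap_measurableType => n _; apply: bigcup_measurable.
move=> w /= H m _ /=; apply: contrapT => nE; apply: H; exists m => n mn En.
by apply: nE; exists n.
Qed.

Lemma measure_series_half_le (D : nat -> set Omega) (p : R) :
  (forall m, measurable (D m)) -> 0 <= p -> (forall m, P (D m) <= (p * 2^-1 ^+ m)%:E)%E ->
  (P (\bigcup_m D m) <= (2 * p)%:E)%E.
Proof.
move=> mD p0 PD.
apply: (@le_trans _ _ (\sum_(0 <= m <oo) P (D m))%E).
  apply: measure_sigma_subadditive => //; exact: bigcup_measurable.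
apply: lime_le; first exact: is_cvg_nneseries.
apply: nearW => n; apply: (@le_trans _ _ (\sum_(0 <= i < n) (p * 2^-1 ^+ i)%:E)%E).
  by apply: lee_sum => i _; exact: PD.
rewrite sumEFin lee_fin -mulr_sumr [leRHS]mulrC ler_wpM2l//.
have -> : \sum_(0 <= i < n) (2^-1 : R) ^+ i = 2 - 2 * 2^-1 ^+ n.
  elim: n => [|n IH]; first by rewrite big_geq// expr0; field.
  by rewrite big_nat_recr//= IH [in RHS]exprS; field.
by rewrite gerBl mulr_ge0// exprn_ge0// invr_ge0.
Qed.

Lemma finite_union_le (N : nat) (D : nat -> set Omega) (p : R) :
  (forall i, measurable (D i)) -> (forall i, (i < N)%N -> P (D i) <= p%:E)%E ->
  (P (\bigcup_(i in `I_N) D i) <= (N%:R * p)%:E)%E.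
Proof.
move=> mD PD; rewrite bigcup_mkord; apply: le_trans (Boole_inequality _ _) _ => //.
apply: (@le_trans _ _ (\sum_(i < N) p%:E)%E); first by apply: lee_sum => i _; exact: PD.
by rewrite sumEFin sumr_const card_ord mulr_natl.
Qed.

End borel_cantelli_bounds.

Section brownian_increments.
Context d (Omega : measurableType d) (R : realType) (P : probability Omega R).
Variables (W : R -> Omega -> R) (u0 : R).
Hypotheses (mW : forall u, measurable_fun setT (W u))
  (cW : forall w, {within `[u0, +oo[, continuous (W ^~ w)})
  (bW : brownian_on_open P W u0).

Definition increment_exceeds (u v x : R) : set Omega := [set w | x < `|W v w - W u w|].

Lemma measurable_increment_exceeds u v x : measurable (increment_exceeds u v x).
Proof.
have : measurable_fun setT (fun w => `|W v w - W u w|).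
  by apply: measurableT_comp => //; apply: measurable_funB.
move=> /(_ measurableT `]x, +oo[%classic (measurable_itv _)); rewrite setTI.
by rewrite set_itvoy.
Qed.

(** The event is that the increment lies in an open set, the union of two rays. *)
Lemma increment_tail u v x : u0 <= u -> u < v -> 0 <= x ->
  (P (increment_exceeds u v x) <= (2 * expR (- (x ^+ 2 / (2 * (v - u)))))%:E)%E.
Proof.
move=> u0u uv x0.
pose t i := u + i%:R * (v - u).
pose O : set R := `]-oo, - x[ `|` `]x, +oo[.
have oO : open O by apply: openU; exact: interval_open.
have t0 : t 0%N = u by rewrite /t mul0r addr0.
have t1 : t 1%N = v by rewrite /t mul1r addrC subrK.
have tS i : t i < t i.+1 by rewrite /t -natr1 mulrDl mul1r addrA ltrDl subr_gt0.
have := @bW 1%N t (fun=> O); rewrite t0 big_nat1 t0 t1 => /(_ u0u tS (fun=> oO)) H.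
have {H} : (P (increment_exceeds u v x) <= normal_prob 0 (Num.sqrt (v - u)) O)%E.
  apply: le_trans H; rewrite le_eqVlt; apply/orP; left; apply/eqP; congr (P _).
  apply/seteqP; split => w.
    rewrite /increment_exceeds/= => xw i; rewrite /= ltnS leqn0 => /eqP ->.
    rewrite t1 t0 /O /= !in_itv/= andbT; move: xw.
    by rewrite ltr_normr ltrNr => /orP[|]; [right|left].
  move=> /(_ 0%N isT); rewrite /increment_exceeds/= t1 t0 /O /= !in_itv/= andbT.
  by rewrite ltr_normr ltrNr => -[->|->]; rewrite ?orbT.
move=> H; apply: le_trans H _.
have s0 : 0 < Num.sqrt (v - u) by rewrite sqrtr_gt0 subr_gt0.
have tail := normal_ray_le s0 x0;
  rewrite sqr_sqrtr ?subr_ge0 ?(ltW uv)// -[X in x ^+ 2 / X]mulr_natl in tail.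
have mI (i : interval R) : measurable ([set` i] : set (measurableTypeR R)) by exact:
  measurable_itv.
have tailN : (normal_prob 0 (Num.sqrt (v - u)) `]-oo, (- x)%R[ <= (expR (- (x ^+ 2 / (2 * (v -
  u)))))%:E)%E.
  apply: le_trans tail; rewrite le_eqVlt; apply/orP; left; apply/eqP.
  rewrite -[RHS]normal_probN// ?gt_eqF//; congr (normal_prob _ _ _).
  by apply/seteqP; split => y /=; rewrite !in_itv/= andbT ltrNr.
have -> : forall e : R, 2 * e = e + e by move=> e; rewrite mulr2n mulrDl mul1r.
apply: le_trans (measureU2 _ (mI _) (mI _)) _.
by rewrite EFinD; apply: leeD.
Qed.

(** The event that some hypothesis of dyadic_chaining fails for a path of W.  Unlike
    the event that the oscillation exceeds 4 c, it is a countable union of events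
    about single increments. *)
Definition chain_fails (a L c : R) : set Omega :=
  \bigcup_m \bigcup_(j in `I_(2 ^ m)) increment_exceeds
     (a + j%:R * (L / (2 ^ m)%:R)) (a + j.+1%:R * (L / (2 ^ m)%:R)) (c * (3 / 4) ^+ m).

Lemma measurable_chain_fails a L c : measurable (chain_fails a L c).
Proof.
by apply: bigcup_measurable => m _; apply: bigcup_measurable => j _;
  exact: measurable_increment_exceeds.
Qed.

Lemma chain_succeeds a L c w : u0 <= a -> 0 < L -> 0 <= c -> ~ chain_fails a L c w ->
  forall u, a <= u <= a + L -> `|W u w - W a w| <= 4 * c.
Proof.
move=> ua L0 c0 nH; apply: dyadic_chaining => //.
  apply: continuous_subspaceW (@cW w).
  by move=> u /=; rewrite !in_itv/= andbT => /andP[au _]; exact: le_trans au.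
move=> m j jm; rewrite leNgt; apply/negP => H; apply: nH.
by exists m => //; exists j.
Qed.

(** At level m there are 2^m increments, each of variance L / 2^m, and they exceed
    c (3/4)^m with probability at most 2 exp (- 16 z (9/8)^m).  By Bernoulli this is
    at most 2 exp (- 16 z) exp (- 2 z m), and z >= ln 2 makes exp (- 2 z) at most
    1/4, which beats the number of increments. *)
Lemma chain_fails_prob a L c z : u0 <= a -> 0 < L -> ln 2 <= z -> 0 <= c ->
  c ^+ 2 = 32 * L * z ->
  (P (chain_fails a L c) <= (4 * expR (- (16 * z)))%:E)%E.
Proof.
move=> ua L0 z2 c0 cE.
have z0 : 0 <= z by rewrite (le_trans _ z2)// ln_ge0// ler1n.
have -> : 4 * expR (- (16 * z)) = 2 * (2 * expR (- (16 * z))) by rewrite mulrA -natrM.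
apply: measure_series_half_le => [m||m].
- by apply: bigcup_measurable => j _; exact: measurable_increment_exceeds.
- by rewrite mulr_ge0 ?expR_ge0.
have h0 : 0 < L / (2 ^ m)%:R by rewrite divr_gt0// ltr0n expn_gt0.
set p := 2 * expR (- (16 * z)) * 2^-1 ^+ m.
have -> : p = (2 ^ m)%:R * (p / (2 ^ m)%:R) by rewrite mulrCA divff ?mulr1// pnatr_eq0 expn_eq0.
apply: finite_union_le => [j|j jm]; first exact: measurable_increment_exceeds.
apply: le_trans (increment_tail _ _ _) _.
- by rewrite (le_trans ua)// lerDl mulr_ge0// ltW.
- by rewrite ltrD2l ltr_pM2r// ltr_nat.
- by rewrite mulr_ge0// exprn_ge0// divr_ge0.
have -> : a + j.+1%:R * (L / (2 ^ m)%:R) - (a + j%:R * (L / (2 ^ m)%:R)) = L / (2 ^ m)%:R.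
  by rewrite -natr1; ring.
have n0 : (2 ^ m)%:R != 0 :> R by rewrite pnatr_eq0 expn_eq0.
have -> : (c * (3 / 4) ^+ m) ^+ 2 / (2 * (L / (2 ^ m)%:R)) = 16 * z * (9 / 8) ^+ m.
  rewrite exprMn cE -exprM mulnC exprM.
  have -> : (9 / 8 : R) ^+ m = ((3 / 4) ^+ 2) ^+ m * (2 ^ m)%:R.
    by rewrite natrX -exprMn; congr (_ ^+ _); field.
  move: ((2 ^ m)%:R : R) n0 => y y0; field.
  by rewrite y0 gt_eqF.
have -> : p / (2 ^ m)%:R = 2 * expR (- (16 * z + m%:R * (2 * ln 2))).
  rewrite /p opprD expRD -!mulrA natrX -exprVn -exprMn; congr (_ * (_ * _)).
  rewrite -mulrN expRM_natl; congr (_ ^+ _).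
  by rewrite -mulrN expRM_natl expRN lnK ?posrE// expr2.
rewrite lee_fin ler_pM2l// ler_expR lerN2.
apply: le_trans (ler_wpM2l _ (bernoulli_nine_eighths m)); last by rewrite mulr_ge0.
rewrite mulrDr mulr1 lerD2l.
have -> : 16 * z * (m%:R / 8) = m%:R * (2 * z) by field.
by rewrite ler_wpM2l// ler_pM2l.
Qed.

(** * The law of the iterated logarithm *)

(** With u_n = exp (s n), the event E says that |W_(u_n) - W_a| exceeds (1 + e)
    times the normalization at u_n, or that the chaining over [u_n, u_(n+1)] fails.  Both
    parts have probability O(exp (- (1 + e) ln (ln u_n))), that is O(n^(- 1 - e)). *)
Lemma lil_upper_bound (e : R) : 0 < e -> e <= 1 ->
  {ae P, forall w, exists M, forall u, M <= u -> `|W u w| <= (1 + 3 * e) * lil_norm u}.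
Proof.
move=> e0 e1.
(* The length of [u_n, u_(n+1)] is (e / 16)^2 u_n, so that chain_fails_prob applies
   with z = ln (ln u_n) and c = e / 4 times the normalization, and the oscillation
   4 c is e times the normalization. *)
pose s := ln (1 + (e / 16) ^+ 2).
have q1 : 1 < 1 + (e / 16) ^+ 2 by rewrite ltrDl exprn_gt0// divr_gt0.
have s0 : 0 < s by rewrite ln_gt0.
have es : expR s = 1 + (e / 16) ^+ 2 by rewrite lnK// posrE (lt_trans ltr01).
pose a := Num.max u0 0.
have a0 : 0 <= a by rewrite le_max lexx orbT.
have ua : u0 <= a by rewrite le_max lexx.
pose n0 := (Num.truncn (Num.max 2 a / s)).+1.
have Hn0 n : (n0 <= n)%N -> Num.max 2 a <= s * n%:R.
  move=> nn0; rewrite mulrC -ler_pdivrMr// (le_trans (ltW (truncnS_gt _)))// ler_nat//.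
pose tt n := lil_time s n.
have tS n : tt n.+1 - tt n = (e / 16) ^+ 2 * tt n.
  by rewrite /tt /lil_time -natr1 mulrDr mulr1 expRD es; ring.
have t0 n : 0 < tt n by exact: expR_gt0.
have lnt n : ln (tt n) = s * n%:R by rewrite /tt /lil_time expRK.
have t_e n : (n0 <= n)%N -> expR 1 <= tt n.
  move=> /Hn0; rewrite ge_max => /andP[s2 _]; rewrite ler_expR (le_trans _ s2)// ler1n//.
have t_a n : (n0 <= n)%N -> a < tt n.
  move=> /Hn0; rewrite ge_max => /andP[_ sa]; rewrite (le_lt_trans sa)//.
  by rewrite (lt_le_trans _ (expR_ge1Dx _))// ltrDr.
have z2 n : (n0 <= n)%N -> ln 2 <= ln (ln (tt n)).
  move=> /Hn0; rewrite ge_max => /andP[s2 _]; rewrite lnt ler_ln ?posrE//.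
  by rewrite (lt_le_trans _ s2).
pose E k := increment_exceeds a (tt (n0 + k).+1) ((1 + e) * lil_norm (tt (n0 + k).+1)) `|`
  chain_fails (tt (n0 + k).+1) (tt (n0 + k).+2 - tt (n0 + k).+1) (e / 4 * lil_norm (tt (n0 +
    k).+1)).
pose C := 6 * expR (- ((1 + e) * ln s)) / e.
have C0 : 0 <= C by rewrite divr_ge0 ?(ltW e0)// mulr_ge0 ?expR_ge0.
have : {ae P, forall w, exists m, forall n, (m <= n)%N -> ~ E n w}.
  apply: (@ae_eventually_not _ _ _ _ _ (fun k => C * expR (- (e * ln (n0 + k)%:R)))).
  - by move=> k; apply: measurableU;
    [exact: measurable_increment_exceeds|exact: measurable_chain_fails].
  - by move=> k; rewrite mulr_ge0 ?expR_ge0.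
  move=> k; set n := (n0 + k).+1.
  have nn0 : (n0 <= n)%N by rewrite /n -addnS leq_addr.
  have n1 : 0 < n%:R :> R by rewrite ltr0n.
  have z0 : 0 <= ln (ln (tt n)) by rewrite lnln_ge0// t_e.
  have h2 := lil_norm_sqr (t_e _ nn0).
  have ezE : expR (- ((1 + e) * ln (ln (tt n)))) = expR (- ((1 + e) * ln s)) * expR (- ((1 + e)
    * ln n%:R)).
    by rewrite lnt lnM ?posrE// mulrDr opprD expRD.
  apply: (@le_trans _ _ (6 * expR (- ((1 + e) * ln (ln (tt n)))))%:E); last first.
    rewrite lee_fin ezE addnS -mulrBr /C mulrA -[leRHS]mulrA ler_wpM2l ?mulr_ge0 ?expR_ge0//.
    by rewrite ler_pdivlMl// telescope_expR_ln.
  have -> : 6 * expR (- ((1 + e) * ln (ln (tt n)))) = 2 * expR (- ((1 + e) * ln (ln (tt n)))) +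
      4 * expR (- ((1 + e) * ln (ln (tt n)))) by ring.
  apply: le_trans (measureU2 _ (measurable_increment_exceeds _ _ _) (measurable_chain_fails _ _
    _)) _.
  rewrite EFinD; apply: leeD.
    apply: le_trans (increment_tail ua (t_a _ nn0) _) _.
      by rewrite mulr_ge0 ?sqrtr_ge0// addr_ge0// ltW.
    rewrite lee_fin ler_pM2l// ler_expR lerN2 exprMn h2.
    have ta : 0 < tt n - a by rewrite subr_gt0 t_a.
    rewrite ler_pdivlMr ?mulr_gt0//.
    have -> : (1 + e) * ln (ln (tt n)) * (2 * (tt n - a)) = (1 + e) * (2 * (tt n - a) * ln (ln
      (tt n))) by ring.
    apply: ler_pM.
    - by rewrite addr_ge0// ltW.
    - by rewrite !mulr_ge0// ltW.
    - by rewrite expr2 ler_peMr ?addr_ge0 ?lerDl ?(ltW e0).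
    - by rewrite ler_wpM2r// ler_pM2l// gerBl.
  apply: le_trans (chain_fails_prob (z := ln (ln (tt n))) _ _ (z2 _ nn0) _ _) _.
  - by rewrite (le_trans ua)// ltW// t_a.
  - by rewrite tS mulr_gt0// exprn_gt0// divr_gt0.
  - by rewrite mulr_ge0 ?sqrtr_ge0// divr_ge0// ltW.
  - by rewrite exprMn h2 tS; field.
  rewrite lee_fin ler_pM2l// ler_expR lerN2 ler_wpM2r//.
  lra.
apply: filterS => w [m Hm].
(* The events control W - W_a only; W_a is absorbed since the normalization tends
   to +oo. *)
pose K := `|W a w| / e.
have K0 : 0 <= K by rewrite divr_ge0// ltW.
exists (Num.max (tt (n0 + m).+1) (Num.max (expR (expR 1)) (K ^+ 2))) => u.
rewrite !ge_max => /and3P[tu eu Ku].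
have u0' : 0 < u by rewrite (lt_le_trans _ tu).
have lu0 : 0 <= ln u.
  rewrite ln_ge0// (le_trans _ eu)// -[leLHS]expR0 ler_expR expR_ge0//.
pose n := Num.truncn (ln u / s).
have nu : s * n%:R <= ln u by rewrite mulrC -ler_pdivlMr// truncn_le// divr_ge0// ltW.
have un : ln u < s * n.+1%:R by rewrite mulrC -ltr_pdivrMr// truncnS_gt.
have nm : (n0 + m < n)%N.
  rewrite -ltnS -(ltr_nat R) -(ltr_pM2l s0) (le_lt_trans _ un)//.
  by rewrite -[leLHS]expRK ler_ln ?posrE ?expR_gt0.
have [k nk mk] : exists2 k, n = (n0 + k).+1 & (m <= k)%N.
  exists (n - n0.+1)%N; first by rewrite -addSn subnKC// (leq_trans _ nm)// ltnS leq_addr.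
  by rewrite leq_subRL ?addSn// (leq_trans _ nm)// ltnS leq_addr.
have nn0 : (n0 <= n)%N by rewrite nk -addnS leq_addr.
have tnu : tt n <= u by rewrite -[leRHS]lnK// ler_expR.
have utn : u <= tt n.+1 by rewrite -[leLHS]lnK// ler_expR ltW.
have := Hm k mk; rewrite /E -nk => /not_orP[nA nB].
have hK : `|W a w| <= e * lil_norm u.
  by rewrite mulrC -ler_pdivrMr// lil_norm_ge.
have hn : lil_norm (tt n) <= lil_norm u by rewrite lil_norm_le// t_e.
have B1 : `|W u w - W (tt n) w| <= 4 * (e / 4 * lil_norm (tt n)).
  apply: (chain_succeeds _ _ _ nB).
  - by rewrite (le_trans ua)// ltW// t_a.
  - by rewrite tS mulr_gt0// exprn_gt0// divr_gt0.
  - by rewrite mulr_ge0 ?sqrtr_ge0// divr_ge0// ltW.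
  - by rewrite tnu addrC subrK.
have A1 : `|W (tt n) w - W a w| <= (1 + e) * lil_norm (tt n).
  by rewrite leNgt; apply/negP.
have -> : W u w = (W u w - W (tt n) w) + (W (tt n) w - W a w) + W a w by ring.
have -> : (1 + 3 * e) * lil_norm u = e * lil_norm u + (1 + e) * lil_norm u + e * lil_norm u by
  ring.
apply: le_trans (ler_normD _ _) _; apply: lerD => //.
apply: le_trans (ler_normD _ _) _; apply: lerD.
  apply: le_trans B1 _; rewrite mulrA (_ : 4 * (e / 4) = e); last by field.
  by rewrite ler_pM2l.
apply: le_trans A1 _; rewrite ler_pM2l// addr_gt0//.
Qed.
(** Here D = e^2.  For u_n = D^(-n), the increment over [u_n, u_(n+1)] has variance
    (1 - D) u_(n+1), so normal_prob_ray_le bounds the probability that it stays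
    below (1 - D) times the normalization at u_(n+1) by 1 - c / (n + 1).  The
    normalization at u_n is at most e times the one at u_(n+1), and |W| is at most
    twice the normalization by lil_upper_bound, whence the loss of e^2 + 2 e, at
    most 3 e. *)
Lemma lil_lower_bound (e : R) : 0 < e -> e < 1 ->
  {ae P, forall w, forall M, exists2 u, M <= u & (1 - 3 * e) * lil_norm u <= W u w}.
Proof.
move=> e0 e1.
pose D := e ^+ 2.
have D0 : 0 < D by rewrite exprn_gt0.
have D1 : D < 1 by rewrite expr_lt1// ltW.
pose s := - ln D.
have s0 : 0 < s by rewrite oppr_gt0 ln_lt0// D0.
have es : expR (- s) = D by rewrite opprK lnK.
pose n0 := (Num.truncn (Num.max 1 u0 / s)).+1.
have Hn0 n : (n0 <= n)%N -> Num.max 1 u0 <= s * n%:R.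
  move=> nn0; rewrite mulrC -ler_pdivrMr// (le_trans (ltW (truncnS_gt _)))// ler_nat//.
pose tt n := lil_time s n.
have tS n : tt n = D * tt n.+1.
  by rewrite /tt /lil_time -es -expRD -natr1; congr expR; ring.
have t0 n : 0 < tt n by exact: expR_gt0.
have tlt n : tt n < tt n.+1 by rewrite /tt /lil_time ltr_expR ltr_pM2l// ltr_nat.
have lnt n : ln (tt n) = s * n%:R by rewrite /tt /lil_time expRK.
have t_e n : (n0 <= n)%N -> expR 1 <= tt n.
  by move=> /Hn0; rewrite ge_max => /andP[s1 _]; rewrite ler_expR.
have t_u0 n : (n0 <= n)%N -> u0 <= tt n.
  move=> /Hn0; rewrite ge_max => /andP[_ su]; rewrite (le_trans su)//.
  by rewrite (le_trans _ (expR_ge1Dx _))// lerDr.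
pose x n := (1 - D) * lil_norm (tt n.+1).
pose F n := [set w | W (tt n.+1) w - W (tt n) w < x n].
have mF n : measurable (F n).
  have /(_ measurableT `]-oo, (x n)[%classic (measurable_itv _)) :
    measurable_fun setT (fun w => W (tt n.+1) w - W (tt n) w) by apply: measurable_funB.
  by rewrite setTI set_itvNyo.
pose c := (Num.sqrt (pi *+ 2))^-1 * expR (- ((1 + D^-1) / 2)) / s.
have c0 : 0 < c.
  by rewrite divr_gt0// mulr_gt0 ?expR_gt0// invr_gt0 sqrtr_gt0 mulrn_wgt0// pi_gt0.
have NF n : (n0 <= n)%N ->
    (normal_prob 0 (Num.sqrt (tt n.+1 - tt n)) `]-oo, (x n)[ <= (1 - c / n.+1%:R)%:E)%E.
  move=> nn0; have en := t_e _ (leqW nn0).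
  have sn : 1 < s * n.+1%:R.
    have := Hn0 _ nn0; rewrite ge_max => /andP[+ _] => /le_lt_trans; apply.
    by rewrite ltr_pM2l// ltr_nat.
  have l0 : 0 < ln (ln (tt n.+1)) by rewrite ln_gt0// lnt.
  apply: le_trans (normal_prob_ray_le (l := ln (ln (tt n.+1))) D0 D1 l0 _ _ _) _.
  - by rewrite sqrtr_gt0 subr_gt0.
  - by rewrite mulr_ge0 ?sqrtr_ge0// subr_ge0 ltW.
  - rewrite exprMn lil_norm_sqr// sqr_sqrtr ?subr_ge0 ?(ltW (tlt _))// (tS n).
    by ring.
  rewrite lee_fin lerD2l lerN2 /c -[leLHS]mulrA [X in _ * X <= _](_ : _ = expR (- ln (ln (tt
    n.+1))))//.
  by rewrite expRN lnK ?posrE ?lnt ?(lt_trans ltr01 sn)// -invfM.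
have PF n : (n0 <= n)%N -> P (\bigcap_k F (n + k)%N) = 0%E.
  move=> nn0; apply/eqP; rewrite eq_le measure_ge0 andbT.
  have le_exp m : (P (\bigcap_k F (n + k)%N) <=
     (expR (- (c * (ln (n + m).+1%:R - ln n.+1%:R))))%:E)%E.
    have := @bW m (fun k => tt (n + k)%N) (fun k => `]-oo, (x (n + k)%N)[%classic).
    rewrite addn0 => /(_ (t_u0 _ nn0)) H.
    apply: (@le_trans _ _ (P (\bigcap_(k in [set k | (0 <= k < m)%N])
      [set w | `]-oo, x (n + k)%N[%classic (W (tt (n + k.+1)%N) w - W (tt (n + k)%N) w)]))).
      apply: le_measure; rewrite ?inE.
      - exact: bigcap_measurableType.
      - apply: bigcap_measurableType => k _.
        rewrite (_ : [set _ | _] = F (n + k)%N)//.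
        by apply/seteqP; split => w; rewrite /F/= in_itv/= addnS.
      - by move=> w Hw k _ /=; rewrite in_itv/= addnS; exact: Hw.
    apply: le_trans (H _ _) _.
    - by move=> i; rewrite addnS.
    - by move=> i; exact: interval_open.
    apply: prod_harmonic_le; first exact: ltW.
    - by move=> k; rewrite measure_ge0.
    - by move=> k; rewrite addnS; apply: NF; rewrite (leq_trans nn0)// leq_addr.
  apply/lee_addgt0Pr => r r0; rewrite add0e.
  pose m := Num.truncn (expR (ln n.+1%:R - ln r / c)).
  apply: le_trans (le_exp m) _; rewrite lee_fin -[leRHS]lnK// ler_expR lerNl.
  rewrite mulrC -ler_pdivrMr// mulNr lerBrDl.
  rewrite -[leLHS]expRK ler_ln ?posrE ?expR_gt0// (le_trans (ltW (truncnS_gt _)))//.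
  by rewrite ler_nat ltnS leq_addl.
have aeF : {ae P, forall w, forall n, (n0 <= n)%N -> exists2 k, (n <= k)%N & ~ F k w}.
  have : P.-negligible (\bigcup_n \bigcap_k F (n0 + n + k)%N).
    apply: negligible_bigcup => n; apply/negligibleP; last by apply: PF; rewrite leq_addr.
    exact: bigcap_measurableType.
  move=> [Z [mZ PZ HZ]]; exists Z; split => // w nw; apply: HZ; apply: contrapT => nU; apply: nw.
  move=> n nn0; apply: contrapT => nF; apply: nU; exists (n - n0)%N => // k _.
  apply: contrapT => nFk; apply: nF; exists (n0 + (n - n0) + k)%N => //.
  by rewrite subnKC// leq_addr.
have e3 : 0 < 3^-1 :> R by [].
have e31 : 3^-1 <= 1 :> R by rewrite invf_le1// ler1n.
apply: filterS2 aeF (lil_upper_bound e3 e31) => w HF [M' HM'].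
move=> M.
pose n := maxn n0 (Num.truncn (Num.max M M' / s)).+1.
have nn0 : (n0 <= n)%N by rewrite leq_maxl.
have [k nk nFk] := HF _ nn0.
have nMM : Num.max M M' <= tt k.
  have : Num.max M M' <= s * k%:R.
    rewrite mulrC -ler_pdivrMr// (le_trans (ltW (truncnS_gt _)))// ler_nat (leq_trans _ nk)//.
    by rewrite leq_maxr.
  by move=> /le_trans; apply; rewrite (le_trans _ (expR_ge1Dx _))// lerDr.
move: nMM; rewrite ge_max => /andP[Mk M'k].
exists (tt k.+1); first by rewrite (le_trans Mk)// ltW.
have ek : expR 1 <= tt k by apply: t_e; rewrite (leq_trans nn0).
move: nFk; rewrite /F /= => /negP; rewrite -leNgt lerBrDr => Hk.
apply: le_trans Hk.
have := HM' _ M'k; rewrite ler_norml => /andP[Wk _].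
have hk : lil_norm (tt k) <= e * lil_norm (tt k.+1).
  have -> : e = Num.sqrt D by rewrite sqrtr_sqr gtr0_norm.
  by apply: lil_norm_scale; rewrite ?(ltW D0) ?(ltW (tlt k)) -?tS.
have h0 : 0 <= lil_norm (tt k.+1) by exact: sqrtr_ge0.
move: Wk hk h0; rewrite /x /D; move: (lil_norm (tt k.+1)) (lil_norm (tt k)) (W (tt k) w) => y1
  y2 y3.
rewrite mulfV// => H1 H2 H3.
have : 0 <= y1 * (e * (1 - e)) by rewrite !mulr_ge0// ?subr_ge0 ltW.
nra.
Qed.

End brownian_increments.

(** The centred Gaussian laws are symmetric. *)
Lemma brownian_on_openN d (Omega : measurableType d) (R : realType) (P : probability Omega R)
    (W : R -> Omega -> R) (u0 : R) :
  brownian_on_open P W u0 -> brownian_on_open P (fun u w => - W u w) u0.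
Proof.
move=> bW n t O ut tS oO.
have oNO k : open (-%R @^-1` O k).
  by apply: open_comp (oO k) => x _; exact: opp_continuous.
have := bW n t (fun k => -%R @^-1` O k) ut tS oNO.
rewrite (_ : \bigcap_(k in [set k | (0 <= k < n)%N]) _ =
  \bigcap_(k in [set k | (0 <= k < n)%N]) [set w | O k (- W (t k.+1) w - - W (t k) w)]);
    last first.
  by apply: eq_bigcapr => k _; apply/seteqP; split => w /=; rewrite opprD.
move=> /le_trans; apply; rewrite le_eqVlt; apply/orP; left; apply/eqP.
apply: eq_bigr => k _; rewrite normal_probN//; last exact: open_measurable.
by rewrite gt_eqF// sqrtr_gt0 subr_gt0.
Qed.

(** * Limits superior at T *)

Section limsup_log_time.
Context {R : realType}.
Implicit Types (T l m : R) (phi : R -> R).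

(** The left neighbourhoods of T are the neighbourhoods of +oo in logarithmic time. *)
Lemma near_left_log_time T (V : set R) :
  (\forall t \near T^'-, V t) <-> exists M : R, forall u, M <= u -> V (log_time T u).
Proof.
split=> [|[M HM]].
  rewrite near_withinE => -[r /= r0 Hr]; exists (- ln r + 1) => u Mu.
  apply: Hr => /=; last exact: log_time_lt.
  rewrite /log_time subKr gtr0_norm ?expR_gt0// -[ltRHS]lnK// ltr_expR ltrNl.
  by rewrite (lt_le_trans _ Mu)// ltrDl.
near=> t.
have tT : 0 < T - t by rewrite subr_gt0; near: t; exact: nbhs_left_lt.
have -> : t = log_time T (- ln (T - t)) by rewrite /log_time opprK lnK// subKr.
apply: HM; rewrite lerNr -[leRHS]expRK ler_ln ?posrE ?expR_gt0// ltW//.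
by near: t; apply: nbhs_left_ltBl; exact: expR_gt0.
Unshelve. all: by end_near. Qed.

Lemma exists_invS_lt (e : R) : 0 < e -> exists k : nat, k.+1%:R^-1 < e :> R.
Proof.
move=> e0; exists (Num.truncn e^-1); rewrite invf_plt ?posrE//.
exact: truncnS_gt.
Qed.

(** The limit superior of z at +oo being l, as countably many conditions on the
    values of z on [m, +oo[, where the processes considered are continuous.
    The negated existence, rather than a bound for all u, reduces measurability to
    a single kind of event. *)
Definition limsup_at_pinfty (m l : R) (z : R -> R) : Prop := forall k : nat,
  (exists M : nat, ~ exists2 u, m + M%:R <= u & l + k.+1%:R^-1 < z u) /\
  (forall M : nat, exists2 u, m + M%:R <= u & l - k.+1%:R^-1 < z u).

Lemma limsup_at_pinfty_limf_esup T phi m l :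
  limsup_at_pinfty m l (phi \o log_time T) -> limf_esup (fun t => (phi t)%:E) T^'- = l%:E.
Proof.
move=> H; apply/eqP; rewrite eq_le; apply/andP; split.
  apply/lee_addgt0Pr => e e0; have [k ke] := exists_invS_lt e0.
  have [[M HM] _] := H k; apply: ge_ereal_inf.
  exists (ereal_sup ((fun t => (phi t)%:E) @` [set t | phi t <= l + e])); last first.
    by apply: ge_ereal_sup => _ [t /= tl <-]; rewrite -EFinD lee_fin.
  eexists => //; apply/near_left_log_time; exists (m + M%:R) => u Mu /=.
  rewrite leNgt; apply/negP => lu; apply: HM; exists u => //=.
  by rewrite (lt_trans _ lu)// ltrD2l.
apply: le_ereal_inf_tmp => _ [V /near_left_log_time[M' HM'] <-].
apply/lee_subgt0Pr => e e0; have [k ke] := exists_invS_lt e0.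
have [_ HM] := H k.
have [u Mu lu] := HM (Num.truncn (Num.max (M' - m) 0)).+1.
apply: le_ereal_sup_tmp; exists (phi (log_time T u))%:E.
  exists (log_time T u) => //; apply: HM'.
  rewrite (le_trans _ Mu)// -lerBlDl (le_trans _ (ltW (truncnS_gt _)))//.
  by rewrite le_max lexx.
by rewrite -EFinB lee_fin (le_trans _ (ltW lu))// lerD2l lerN2 ltW.
Qed.

Lemma limf_esup_limsup_at_pinfty T phi m l :
  limf_esup (fun t => (phi t)%:E) T^'- = l%:E -> limsup_at_pinfty m l (phi \o log_time T).
Proof.
move=> H k; split.
  apply: contrapT => /forallNP nM.
  have : (l%:E + (k.+1%:R^-1)%:E <= l%:E)%E.
    rewrite -[leRHS]H; apply: le_ereal_inf_tmp => _ [V /near_left_log_time[M' HM'] <-].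
    have /contrapT[u Mu lu] := nM (Num.truncn (Num.max (M' - m) 0)).+1.
    apply: le_ereal_sup_tmp; exists (phi (log_time T u))%:E; last first.
      by rewrite -EFinD lee_fin ltW.
    exists (log_time T u) => //; apply: HM'.
    rewrite (le_trans _ Mu)// -lerBlDl (le_trans _ (ltW (truncnS_gt _)))//.
    by rewrite le_max lexx.
  by rewrite -EFinD lee_fin gerDl leNgt invr_gt0 ltr0n.
move=> M; apply: contrapT => nu.
have : (l%:E <= l%:E - (k.+1%:R^-1)%:E)%E.
  rewrite -[leLHS]H; apply: ge_ereal_inf.
  exists (ereal_sup ((fun t => (phi t)%:E) @` [set t | phi t <= l - k.+1%:R^-1])); last first.
    by apply: ge_ereal_sup => _ [t /= tl <-]; rewrite -EFinB lee_fin.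
  eexists => //; apply/near_left_log_time; exists (m + M%:R) => u Mu /=.
  by rewrite leNgt; apply/negP => lu; apply: nu; exists u.
by rewrite -EFinB lee_fin lerDl oppr_ge0 leNgt invr_gt0 ltr0n.
Qed.

Lemma limf_esup_eq_pinfty T phi m :
  limf_esup (fun t => (phi t)%:E) T^'- = +oo%E <->
  forall k M : nat, exists2 u, m + M%:R <= u & k%:R < phi (log_time T u).
Proof.
split=> [H k M|H].
  apply: contrapT => nu.
  have : (+oo <= (k%:R : R)%:E)%E.
    rewrite -[leLHS]H; apply: ge_ereal_inf.
    exists (ereal_sup ((fun t => (phi t)%:E) @` [set t | phi t <= k%:R])); last first.
      by apply: ge_ereal_sup => _ [t /= tl <-]; rewrite lee_fin.
    eexists => //; apply/near_left_log_time; exists (m + M%:R) => u Mu /=.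
    by rewrite leNgt; apply/negP => lu; apply: nu; exists u.
  by rewrite leye_eq.
apply/eqP; rewrite -leye_eq; apply: le_ereal_inf_tmp => _ [V /near_left_log_time[M' HM'] <-].
rewrite leye_eq; apply/eqP/eqyP => A A0.
have [u Mu lu] := H (Num.truncn A).+1 (Num.truncn (Num.max (M' - m) 0)).+1.
apply: le_ereal_sup_tmp; exists (phi (log_time T u))%:E.
  exists (log_time T u) => //; apply: HM'.
  rewrite (le_trans _ Mu)// -lerBlDl (le_trans _ (ltW (truncnS_gt _)))//.
  by rewrite le_max lexx.
by rewrite lee_fin ltW// (lt_trans _ lu)// truncnS_gt.
Qed.

End limsup_log_time.

Section limsup_events.
Context d (Omega : measurableType d) (R : realType) (P : probability Omega R).
Variables (Z : R -> Omega -> R) (m : R).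
Hypotheses (mZ : forall u, measurable_fun setT (Z u))
  (cZ : forall w, {within `[m, +oo[, continuous (Z ^~ w)}).

(** By continuity, if Z_u > c then Z_q > c for the rational numbers q slightly larger
    than u. *)
Lemma measurable_exists_gt (a c : R) : m <= a ->
  measurable [set w | exists2 u, a <= u & c < Z u w].
Proof.
move=> ma.
have -> : [set w | exists2 u, a <= u & c < Z u w] =
    \bigcup_(q : rat) [set w | a <= ratr q /\ c < Z (ratr q) w].
  apply/seteqP; split => [w /= [u au cu]|w [q _ [/= aq cq]]]; last by exists (ratr q).
  have mu : `[m, +oo[%classic u by rewrite /= in_itv/= andbT (le_trans ma).
  have e0 : 0 < Z u w - c by rewrite subr_gt0.
  have [r r0 Hr] := within_continuous_dist (@cZ w) mu e0.
  have [q] : exists q : rat, ratr q \in `]u, (u + r)[ by apply: rat_in_itvoo; rewrite ltrDl.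
  rewrite in_itv/= => /andP[uq qu]; exists q => //; split; first by rewrite (le_trans au)// ltW.
  have := Hr (ratr q); rewrite /= in_itv/= andbT (le_trans (le_trans ma au) (ltW uq)).
  rewrite distrC ger0_norm ?subr_ge0 ?(ltW uq)// ltrBlDl => /(_ isT qu).
  by rewrite ltr_norml => /andP[_]; rewrite ltrD2l ltrN2.
apply: bigcupT_measurable_rat => q.
have [aq|aq] := leP a (ratr q); last first.
  by rewrite (_ : [set w | _] = set0)//; apply/seteqP; split => // w /= [].
rewrite (_ : [set w | _] = [set w | c < Z (ratr q) w]); last first.
  by apply/seteqP; split => w /=; [case|split].
have /(_ measurableT `]c, +oo[%classic (measurable_itv _)) := mZ (ratr q).
by rewrite setTI set_itvoy.
Qed.

Lemma measurable_limsup_at_pinfty l : measurable [set w | limsup_at_pinfty m l (Z ^~ w)].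
Proof.
have mM (M : nat) : m <= m + M%:R by rewrite lerDl.
rewrite (_ : [set w | _] = \bigcap_k (
   (\bigcup_M ~` [set w | exists2 u, m + M%:R <= u & l + k.+1%:R^-1 < Z u w]) `&`
   (\bigcap_M [set w | exists2 u, m + M%:R <= u & l - k.+1%:R^-1 < Z u w]))).
  apply: bigcapT_measurable => k; apply: measurableI.
    by apply: bigcup_measurable => M _; apply: measurableC; exact: measurable_exists_gt.
  by apply: bigcapT_measurable => M; exact: measurable_exists_gt.
apply/seteqP; split => w /= H k.
  by move=> _; have [[M HM] HM'] := H k; split; [exists M|move=> M' _; exact: HM'].
by have [[M _ HM] HM'] := H k I; split; [exists M|move=> M'; exact: HM'].
Qed.

Lemma measurable_unbounded :
  measurable [set w | forall k M : nat, exists2 u, m + M%:R <= u & k%:R < Z u w].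
Proof.
rewrite (_ : [set w | _] = \bigcap_k \bigcap_M [set w | exists2 u, m + M%:R <= u & k%:R < Z u w]).
  apply: bigcapT_measurable => k; apply: bigcapT_measurable => M.
  by apply: measurable_exists_gt; rewrite lerDl.
by apply/seteqP; split => w /= H k; [move=> _ M _|move=> M]; exact: H.
Qed.

End limsup_events.

(** * Conclusion *)

Section law_of_the_iterated_logarithm.
Context d (Omega : measurableType d) (R : realType) (P : probability Omega R).
Variables (W : R -> Omega -> R) (u0 : R).
Hypotheses (mW : forall u, measurable_fun setT (W u))
  (cW : forall w, {within `[u0, +oo[, continuous (W ^~ w)})
  (bW : brownian_on_open P W u0).

(* Beyond exp 2 the iterated logarithm is positive, so that the normalization does
   not vanish. *)
Let m := Num.max u0 (expR 2).

Let lil_norm_gt0 u : m <= u -> 0 < lil_norm u.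
Proof.
rewrite ge_max => /andP[_ eu].
have u0' : 0 < u by rewrite (lt_le_trans _ eu) ?expR_gt0.
rewrite sqrtr_gt0 !mulr_gt0// ln_gt0//.
by rewrite (lt_le_trans (_ : 1 < 2))// ?ltr1n// -[leLHS]expRK ler_ln ?posrE ?expR_gt0.
Qed.

Let continuous_ratio w : {within `[m, +oo[, continuous (fun u => W u w / lil_norm u)}.
Proof.
apply/subspace_continuousP => u; rewrite /= in_itv/= andbT => mu.
have [u0u eu] : u0 <= u /\ expR 2 <= u by move: mu; rewrite ge_max => /andP[].
have uu : 0 < u by rewrite (lt_le_trans _ eu) ?expR_gt0.
have lu : 0 < ln u by rewrite (lt_le_trans (_ : 0 < 2))// -[leLHS]expRK ler_ln ?posrE ?expR_gt0.
have sub : `[m, +oo[%classic `<=` `[u0, +oo[%classic.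
  by apply: subset_itvr; rewrite bnd_simp /m le_max lexx.
apply: cvgM.
  have /subspace_continuousP := continuous_subspaceW sub (@cW w).
  by apply; rewrite /= in_itv/= andbT.
apply: cvg_within_filter; apply: cvgV; first by rewrite gt_eqF// lil_norm_gt0.
apply: continuous_cvg; first exact: sqrt_continuous.
apply: cvgM; first by apply: cvgM; [exact: cvg_cst|exact: cvg_id].
apply: continuous_cvg; first exact: continuous_ln.
exact: continuous_ln.
Qed.

Let measurable_ratio u : measurable_fun setT (fun w => W u w / lil_norm u).
Proof. by apply: measurable_funM. Qed.

Let ae_limsup : {ae P, forall w, limsup_at_pinfty m 1 (fun u => W u w / lil_norm u)}.
Proof.
apply: ae_foralln => k.
have k0 : 0 < k.+1%:R^-1 :> R by rewrite invr_gt0 ltr0n.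
have k1 : k.+1%:R^-1 <= 1 :> R by rewrite invf_le1 ?ltr0n// ler1n.
(* Strictly smaller than a third of 1 / (k + 1): the definition of limsup_at_pinfty
   asks for a strict inequality on the lower side. *)
pose e : R := k.+1%:R^-1 / 6.
have [e0 [e1 e3]] : 0 < e /\ e < 1 /\ 3 * e < k.+1%:R^-1.
  by rewrite /e; move: (k.+1%:R^-1 : R) k0 k1 => y y0 y1; split; [|split]; lra.
apply: filterS2 (lil_upper_bound mW cW bW e0 (ltW e1)) (lil_lower_bound mW cW bW e0 e1).
move=> w [M HM] Hlow; split.
  exists (Num.truncn (Num.max (M - m) 0)).+1 => -[u Mu].
  have mu : m <= u by rewrite (le_trans _ Mu)// lerDl.
  rewrite ltr_pdivlMr ?lil_norm_gt0//; apply/negP; rewrite -leNgt.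
  apply: le_trans (ler_norm _) _; apply: le_trans (HM u _) _.
    rewrite (le_trans _ Mu)// -lerBlDl (le_trans _ (ltW (truncnS_gt _)))//.
    by rewrite le_max lexx.
  by rewrite ler_wpM2r ?sqrtr_ge0// lerD2l ltW.
move=> N; have [u Nu Wu] := Hlow (m + N%:R).
have mu : m <= u by rewrite (le_trans _ Nu)// lerDl.
exists u => //; rewrite ltr_pdivlMr ?lil_norm_gt0//; apply: lt_le_trans Wu.
by rewrite ltr_pM2r ?lil_norm_gt0// ltrD2l ltrN2.
Qed.

Lemma limsup_lil (T : R) (Phi : R -> Omega -> R) :
  (forall u w, Phi (log_time T u) w = W u w / lil_norm u) ->
  P [set w | limf_esup (fun t => (Phi t w)%:E) T^'- = 1%E] = 1%E.
Proof.
move=> PhiE.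
have E w : (fun u => W u w / lil_norm u) = (Phi ^~ w) \o log_time T.
  by apply/funext => u; rewrite /= PhiE.
rewrite (_ : [set w | _] = [set w | limsup_at_pinfty m 1 (fun u => W u w / lil_norm u)]).
  apply: probability_ae1; last exact: ae_limsup.
  by apply: (measurable_limsup_at_pinfty (Z := fun u w => W u w / lil_norm u)).
apply/seteqP; split => w /=; rewrite E.
  exact: limf_esup_limsup_at_pinfty.
exact: limsup_at_pinfty_limf_esup.
Qed.

(** lil_lower_bound with e = 1/6 gives W_u at least half of the normalization for
    arbitrarily large u. *)
Lemma limsup_unbounded (T : R) (Phi : R -> Omega -> R) :
  (forall u w, Phi (log_time T u) w = W u w) ->
  P [set w | limf_esup (fun t => (Phi t w)%:E) T^'- = +oo%E] = 1%E.
Proof.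
move=> PhiE.
rewrite (_ : [set w | _] = [set w | forall k M : nat, exists2 u, u0 + M%:R <= u & k%:R < W u w]).
  apply: probability_ae1; first exact: measurable_unbounded.
  have e0 : 0 < 6^-1 :> R by [].
  have e1 : 6^-1 < 1 :> R by rewrite invf_lt1// ltr1n.
  apply: filterS (lil_lower_bound mW cW bW e0 e1) => w Hw k M.
  have [u] := Hw (Num.max (u0 + M%:R) (Num.max (expR (expR 1)) ((2 * k.+1%:R) ^+ 2))).
  rewrite !ge_max => /and3P[Mu eu ku] Wu; exists u => //; apply: lt_le_trans Wu.
  have : 2 * k.+1%:R <= lil_norm u by rewrite lil_norm_ge// mulr_ge0.
  rewrite (_ : 1 - 3 * 6^-1 = 2^-1 :> R); last by field.
  by rewrite mulrC -ler_pdivlMr// mulrC; apply: lt_le_trans; rewrite ltr_nat.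
apply/seteqP; split => w /=.
  by move=> /(limf_esup_eq_pinfty _ _ u0) H k M; have [u] := H k M; rewrite PhiE => ? ?; exists u.
move=> H; apply/(limf_esup_eq_pinfty _ _ u0) => k M.
by have [u ? ?] := H k M; exists u; rewrite ?PhiE.
Qed.

End law_of_the_iterated_logarithm.

Theorem theorem3p3 (R : realType) (d : measure_display)
    (Omega : measurableType d) (P : probability Omega R)
    (T : R) (hT : 0 < T)
    (B X : R -> {RV P >-> R})
    (hB : standard_wiener_process B)
    (hX : bridge_strong_solution 2^-1 T B X) :
  let normalization (t : R) : R :=
    Num.sqrt (2 * (T - t) * ln (1 / (T - t)) * ln (ln (ln (1 / (T - t))))) in
  (P [set w | limf_esup (fun t : R => (X t w / normalization t)%:E) T^'- = 1%E] = 1%E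
   /\
   P [set w | limf_einf (fun t : R => (X t w / normalization t)%:E) T^'- = (-1)%E]
     = 1%E)
  /\
  (P [set w | limf_esup (fun t : R => (X t w / Num.sqrt (T - t))%:E) T^'- = +oo%E]
     = 1%E
   /\
   P [set w | limf_einf (fun t : R => (X t w / Num.sqrt (T - t))%:E) T^'- = -oo%E]
     = 1%E).
Proof.
move=> normalization.
pose W := log_bridge_process T X.
have mW u : measurable_fun setT (W u) by exact: measurable_log_bridge_process.
have cW w : {within `[- ln T, +oo[, continuous (W ^~ w)}.
  exact: (continuous_log_bridge_process hT hX).
have bW : brownian_on_open P W (- ln T) by exact: (log_bridge_on_open hT hB hX).
have mNW u : measurable_fun setT (fun w => - W u w) by apply: measurable_funN.
have cNW w : {within `[- ln T, +oo[, continuous (fun u => - W u w)}.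
  apply/subspace_continuousP => u Tu; apply: cvgN.
  by have /subspace_continuousP := cW w; exact.
have bNW := brownian_on_openN bW.
have normE u : normalization (log_time T u) = Num.sqrt (T - log_time T u) * lil_norm u.
  have lnE : ln (1 / (T - log_time T u)) = u.
    by rewrite /log_time subKr div1r -expRN opprK expRK.
  rewrite /normalization lnE -sqrtrM; last by rewrite subr_ge0 ltW// log_time_lt.
  by congr Num.sqrt; ring.
have ratioE u w : X (log_time T u) w / normalization (log_time T u) = W u w / lil_norm u.
  by rewrite normE invfM mulrA.
split; split.
- exact: (limsup_lil mW cW bW (Phi := fun t w => X t w / normalization t)).
- rewrite -[RHS](limsup_lil mNW cNW bNW (T := T) (Phi := fun t w => - (X t w / normalization
  t))); last first.
    by move=> u w; rewrite ratioE mulNr.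
  congr (P _); apply/seteqP; split => w /=; rewrite /limf_einf.
    by move=> /(congr1 -%E); rewrite oppeK /= opprK.
  by move=> /= ->.
- exact: (limsup_unbounded mW cW bW (Phi := fun t w => X t w / Num.sqrt (T - t))).
- rewrite -[RHS](limsup_unbounded mNW cNW bNW (T := T) (Phi := fun t w => - (X t w / Num.sqrt
  (T - t))))//.
  congr (P _); apply/seteqP; split => w /=; rewrite /limf_einf.
    by move=> /(congr1 -%E); rewrite oppeK.
  by move=> /= ->.
Qed.
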